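(* Let $n\ge2$, let $X\subset(\mathbb R^n)^k$ be compact and $f\colon X\to(\mathbb R^n)^m$ a map. The following are equivalent: (1) there is a (cabled) linkage in $\mathbb R^n$ which is strongly functional for $f$ with domain $X$; (2) there are a quasialgebraic set $Y$ and polynomial maps $q\colon Y\to X$ and $p\colon Y\to(\mathbb R^n)^m$ such that (a) $p=f\circ q$ and (b) $q$ is an analytic isomorphism onto $X$.
   Context: A cabled linkage in $\mathbb R^n$ is $\mathcal L=(L,\ell,V,\mu,F)$: $L$ a finite one-dimensional simplicial complex (vertex set $\mathcal V(L)$, edge set $\mathcal E(L)$), $\ell\colon\mathcal E(L)\to(0,\infty)$, $V\subset\mathcal V(L)$ fixed vertices, $\mu\colon V\to\mathbb R^n$, $F\subset\mathcal E(L)$ flexible edges. $\mathcal C(\mathcal L)=\{\varphi\colon\mathcal V(L)\to\mathbb R^n\mid\varphi(v)=\mu(v)\ (v\in V),\ |\varphi(v)-\varphi(w)|\le\ell(vw)\ (vw\in F),\ |\varphi(v)-\varphi(w)|=\ell(vw)\ (vw\in\mathcal E(L)\setminus F)\}$. $\mathcal L$ is strongly functional for $f$ with domain $X$ if there are vertices $w_1,\dots,w_k$, $v_1,\dots,v_m$ such that the input map $q(\varphi)=(\varphi(w_1),\dots,\varphi(w_k))$ and output map $p(\varphi)=(\varphi(v_1),\dots,\varphi(v_m))$ satisfy $p=f\circ q$, $q(\mathcal C(\mathcal L))=X$, and $q\colon\mathcal C(\mathcal L)\to X$ is an analytic isomorphism (a homeomorphism which, together with its inverse, is a restriction of an analytic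 map). A quasialgebraic set is a set $\{x\in\mathbb R^N\mid p_i(x)=0,\ q_j(x)\ge0\}$ for finitely many real polynomials $p_i,q_j$. *)

(* Defs.v *)
From HB Require Import structures.
From mathcomp Require Import all_boot all_order all_algebra.
From mathcomp Require Import all_classical all_reals all_analysis.
Set Implicit Arguments. Unset Strict Implicit. Unset Printing Implicit Defensive.
Import Order.TTheory GRing.Theory Num.Theory.
Import numFieldNormedType.Exports.
Local Open Scope classical_set_scope.
Local Open Scope ring_scope.

(* Points of (R^n)^k are k x n matrices (row i = i-th point of R^n);
   points of R^N are 1 x N matrices. *)

Section Defs.
Variable R : realType.

Definition monom (a b : nat) (x0 x : 'M[R]_(a,b)) (alpha : 'I_a * 'I_b -> nat) : R :=
  \prod_(i < a) \prod_(j < b) (x i j - x0 i j) ^+ alpha (i, j).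

Definition box_sum (a b : nat) (c : ('I_a * 'I_b -> nat) -> R)
    (x0 x : 'M[R]_(a,b)) (d : nat) : R :=
  \sum_(al : {ffun 'I_a * 'I_b -> 'I_d.+1})
     c (fun ij => nat_of_ord (al ij)) * monom x0 x (fun ij => nat_of_ord (al ij)).

Definition box_abs_sum (a b : nat) (c : ('I_a * 'I_b -> nat) -> R)
    (x0 x : 'M[R]_(a,b)) (d : nat) : R :=
  \sum_(al : {ffun 'I_a * 'I_b -> 'I_d.+1})
     `| c (fun ij => nat_of_ord (al ij)) * monom x0 x (fun ij => nat_of_ord (al ij)) |.

Definition analytic_fun_on (a b : nat) (U : set 'M[R]_(a,b)) (g : 'M[R]_(a,b) -> R) :=
  open U /\
  forall x0, U x0 -> exists r : R, 0 < r /\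
    exists c : ('I_a * 'I_b -> nat) -> R,
      forall x : 'M[R]_(a,b), (forall i j, `| x i j - x0 i j | < r) ->
        (exists B : R, forall d : nat, box_abs_sum c x0 x d <= B) /\
        (box_sum c x0 x @ \oo --> g x).

Definition analytic_map_on (a b c d : nat) (U : set 'M[R]_(a,b))
    (H : 'M[R]_(a,b) -> 'M[R]_(c,d)) :=
  open U /\ forall i j, analytic_fun_on U (fun x => H x i j).

Definition analytic_restriction (a b c d : nat) (A : set 'M[R]_(a,b))
    (h : 'M[R]_(a,b) -> 'M[R]_(c,d)) :=
  exists U : set 'M[R]_(a,b), A `<=` U /\
    exists H, analytic_map_on U H /\ forall x, A x -> H x = h x.

Definition analytic_iso (a b c d : nat) (A : set 'M[R]_(a,b)) (B : set 'M[R]_(c,d))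
    (h : 'M[R]_(a,b) -> 'M[R]_(c,d)) :=
  h @` A = B /\
  exists g : 'M[R]_(c,d) -> 'M[R]_(a,b),
    (forall x, A x -> g (h x) = x) /\ (forall y, B y -> h (g y) = y) /\
    {within A, continuous h} /\ {within B, continuous g} /\
    analytic_restriction A h /\ analytic_restriction B g.

Definition poly_fun (a b : nat) (g : 'M[R]_(a,b) -> R) :=
  exists (d : nat) (c : {ffun 'I_a * 'I_b -> 'I_d.+1} -> R),
    forall x, g x = \sum_(al : {ffun 'I_a * 'I_b -> 'I_d.+1})
                      c al * \prod_(i < a) \prod_(j < b) x i j ^+ al (i, j).

Definition poly_map (a b c d : nat) (h : 'M[R]_(a,b) -> 'M[R]_(c,d)) :=
  forall i j, poly_fun (fun x => h x i j).

Definition quasialgebraic (N : nat) (Y : set 'rV[R]_N) :=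
  exists (s t : nat) (P : 'I_s -> 'rV[R]_N -> R) (Q : 'I_t -> 'rV[R]_N -> R),
    (forall i, poly_fun (P i)) /\ (forall j, poly_fun (Q j)) /\
    Y = [set x | (forall i, P i x = 0) /\ (forall j, 0 <= Q j x)].

Definition edist (n : nat) (u v : 'rV[R]_n) : R :=
  Num.sqrt (\sum_(j < n) (u ord0 j - v ord0 j) ^+ 2).

End Defs.

(* A cabled linkage in R^n.  The underlying finite 1-dimensional simplicial
   complex has vertex set 'I_nv and edge set [edges] (2-element subsets). *)
Record cabled_linkage (R : realType) (n : nat) := CabledLinkage {
  nv : nat;
  edges : {set {set 'I_nv}};
  edges_card2 : forall e, e \in edges -> #|e| = 2;
  len : {set 'I_nv} -> R;
  len_pos : forall e, e \in edges -> 0 < len e;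
  fixed : {set 'I_nv};
  mu : 'I_nv -> 'rV[R]_n;        (* only used on fixed vertices *)
  flex : {set {set 'I_nv}};
  flex_sub : flex \subset edges
}.

Definition config_space (R : realType) (n : nat) (L : cabled_linkage R n)
  : set 'M[R]_(nv L, n) :=
  [set phi | (forall v, v \in fixed L -> row v phi = @mu _ _ L v) /\
     (forall v w : 'I_(nv L), [set v; w]%SET \in flex L ->
        edist (row v phi) (row w phi) <= @len _ _ L [set v; w]%SET) /\
     (forall v w : 'I_(nv L), [set v; w]%SET \in edges L -> [set v; w]%SET \notin flex L ->
        edist (row v phi) (row w phi) = @len _ _ L [set v; w]%SET)].
Arguments config_space {R n} L.

Definition strongly_functional (R : realType) (n k m : nat) (L : cabled_linkage R n)
    (f : 'M[R]_(k,n) -> 'M[R]_(m,n)) (X : set 'M[R]_(k,n)) :=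
  exists (w : 'I_k -> 'I_(nv L)) (v : 'I_m -> 'I_(nv L)),
    let q := fun phi : 'M[R]_(nv L, n) => \matrix_(i < k, j < n) phi (w i) j in
    let p := fun phi : 'M[R]_(nv L, n) => \matrix_(i < m, j < n) phi (v i) j in
    (forall phi, config_space L phi -> p phi = f (q phi)) /\
    q @` config_space L = X /\
    analytic_iso (config_space L) X q.

(* Main.v *)
Require Import Defs.
From HB Require Import structures.
From mathcomp Require Import all_boot all_order all_algebra.
From mathcomp Require Import all_classical all_reals all_analysis.
From mathcomp Require Import ring lra zify.
Import Order.TTheory GRing.Theory Num.Theory.
Import numFieldNormedType.Exports.
Local Open Scope classical_set_scope.
Local Open Scope ring_scope.
Set Implicit Arguments. Unset Strict Implicit. Unset Printing Implicit Defensive.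

(** A configuration space is itself quasialgebraic, which gives (1) => (2).

    For (2) => (1), the coordinates y_l of the compact set Y are generated by
    points running on arcs of circles through a common point, which an inversion
    straightens into segments.  The mechanism is the Peaucellier cell: for P in a
    plane it provides vertices A and B, equidistant from the origin and from P, with
    A + B - P = P / |P|^2.  On a line this is s |-> 1/s, and
    2 / (1 - x^2) = 1 / (1 - x) + 1 / (1 + x) then yields squares, hence products
    and all polynomials.  Vectors that are sums of arms of constant length can be added
    and scaled by parallelograms, braced so that they stay parallelograms in every
    dimension.  Finally cables impose P_i(y) = 0 and Q_j(y) >= 0.

    Each vertex is a function of y built with +, *, inverses and square roots that
    never degenerate on Y, so the inverse of the input map is analytic as soon as
    analytic functions are closed under these operations.  The last two reduce to the
    quadratic equation b = A + (B + g b) b without constant terms, which is solved by a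
    majorant argument on coefficients. *)

(** * Power series in several variables *)

(** Strong functionality shapes every gadget: the input must determine the configuration, and do so
    analytically, so no gadget may have a second assembly mode. Hence cables cut circles down to
    half circles on which an elbow is unique, and parallelograms carry a brace. Bars also impose
    constant lengths: a varying quantity such as [f(y) e] cannot be a side of a parallelogram, so it
    is carried as a sum of arms and the linear operations act on the arms.

    The gadgets are built over a box [D] containing [Y] rather than over [Y], because the
    coordinates must be independent when they are introduced; the constraints come last. On the box
    every quantity is bounded, so a small multiple [e f] keeps [1 + e f] in [3/4, 5/4], where one
    inverter of fixed dimensions never degenerates.

    Analyticity is tracked only along [G], an analytic extension of the inverse of [q] to a
    neighbourhood of [X]: since [G] maps [X] into [D], nondegeneracy on [D] gives it on [X], and by
    continuity near [X]. *)

Section BoxSums.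
Variables (R : realType) (I : finType).
Implicit Types (c e u v : (I -> nat) -> R) (al be : I -> nat) (d : nat).

Definition bsum d c : R := \sum_(al : {ffun I -> 'I_d.+1}) c (fun i => nat_of_ord (al i)).

Definition mle al d := [forall i, al i <= d]%N.

Lemma mle_ord d (al : {ffun I -> 'I_d.+1}) : mle (fun i => al i) d.
Proof. by apply/forallP => i; rewrite -ltnS ltn_ord. Qed.

Lemma eq_bsum d c e : (forall al, mle al d -> c al = e al) -> bsum d c = bsum d e.
Proof. by move=> h; apply: eq_bigr => al _; apply: h; apply: mle_ord. Qed.

Lemma ler_bsum d c e : (forall al, mle al d -> c al <= e al) -> bsum d c <= bsum d e.
Proof. by move=> h; apply: ler_sum => al _; apply: h; apply: mle_ord. Qed.

Lemma bsum_ge0 d c : (forall al, mle al d -> 0 <= c al) -> 0 <= bsum d c.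
Proof. by move=> h; apply: sumr_ge0 => al _; apply: h; apply: mle_ord. Qed.

Lemma bsumD d c e : bsum d (fun al => c al + e al) = bsum d c + bsum d e.
Proof. by rewrite /bsum big_split. Qed.

Lemma bsumZ d k c : bsum d (fun al => k * c al) = k * bsum d c.
Proof. by rewrite /bsum mulr_sumr. Qed.

Lemma ler_norm_bsum d c : `|bsum d c| <= bsum d (fun al => `|c al|).
Proof. exact: ler_norm_sum. Qed.

Lemma bsum_widen d d' c : (d <= d')%N -> (forall al, ~~ mle al d -> c al = 0) ->
  bsum d' c = bsum d c.
Proof.
move=> dd' c0; rewrite /bsum.
rewrite (bigID (fun al : {ffun I -> 'I_d'.+1} => mle (fun i => al i) d)) /=.
rewrite [X in _ + X]big1 ?addr0; last by move=> al /c0.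
have dd : (d.+1 <= d'.+1)%N by [].
rewrite (reindex_onto (fun al : {ffun I -> 'I_d.+1} => [ffun i => widen_ord dd (al i)])
  (fun al : {ffun I -> 'I_d'.+1} => [ffun i => inord (al i) : 'I_d.+1])) /=; last first.
  move=> al /forallP h; apply/ffunP => i; rewrite !ffunE; apply/val_inj => /=.
  by rewrite inordK // ltnS; apply: h.
apply: eq_big => [al|al _].
  rewrite (_ : mle _ _); last first.
    by apply/forallP => i; rewrite ffunE /= -ltnS.
  by apply/eqP/ffunP => i; rewrite !ffunE /= inord_val.
by congr c; apply/funext => i; rewrite ffunE.
Qed.

Lemma mleW al d d' : (d <= d')%N -> mle al d -> mle al d'.
Proof. by move=> dd /forallP h; apply/forallP => i; apply: leq_trans dd. Qed.

Lemma bsum_mono d d' c : (forall al, 0 <= c al) -> (d <= d')%N -> bsum d c <= bsum d' c.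
Proof.
move=> c0 dd'.
have -> : bsum d c = bsum d (fun al => if mle al d then c al else 0).
  by apply: eq_bsum => al ->.
rewrite -(@bsum_widen d d') //; last by move=> al /negbTE ->.
by apply: ler_bsum => al _; case: ifP.
Qed.

Definition leqm be al := [forall i, be i <= al i]%N.
Definition subm al be : I -> nat := fun i => (al i - be i)%N.
Definition addm al be : I -> nat := fun i => (al i + be i)%N.

(** The Cauchy product. The box of side [\max_i al i] contains every index below [al]; by [conv_box]
    any larger box gives the same value. *)
Definition conv c e al : R :=
  bsum (\max_i al i) (fun be => if leqm be al then c be * e (subm al be) else 0).

Lemma conv_box d c e al : mle al d ->
  conv c e al = bsum d (fun be => if leqm be al then c be * e (subm al be) else 0).
Proof.
move=> /forallP h; rewrite /conv -(@bsum_widen (\max_i al i) d) //.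
  by apply/bigmax_leqP => i _.
move=> be /forallPn [i]; rewrite -ltnNge => hi; case: ifP => // /forallP /(_ i) h2.
by have := leq_trans hi h2; rewrite ltnNge leq_bigmax.
Qed.

Lemma conv_eq c c' e e' al :
  (forall be, leqm be al -> c be = c' be) -> (forall be, leqm be al -> e be = e' be) ->
  conv c e al = conv c' e' al.
Proof.
move=> hc he; apply: eq_bsum => be _; case: ifP => // h; rewrite hc // he //.
by apply/forallP => i; apply: leq_subr.
Qed.

(** Substituting [al = be + ga] gives a sum over pairs, in which the truncation survives as the
    condition that [be + ga] stay in the box. In this form it can be compared with a product of box
    sums. *)
Lemma bsum_conv d u v : bsum d (conv u v) =
  bsum d (fun be => bsum d (fun ga => if mle (addm be ga) d then u be * v ga else 0)).
Proof.
under eq_bsum => al hal do rewrite (conv_box _ _ hal).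
rewrite /bsum exchange_big /=; apply: eq_bigr => be _.
rewrite -2!big_mkcond /=.
rewrite (reindex_onto (fun ga : {ffun I -> 'I_d.+1} => [ffun i => inord (be i + ga i) : 'I_d.+1])
  (fun al : {ffun I -> 'I_d.+1} => [ffun i => inord (al i - be i) : 'I_d.+1])) /=; last first.
  move=> al /forallP h; apply/ffunP => i; rewrite !ffunE; apply/val_inj => /=.
  have h1 := h i; have h2 := ltn_ord (al i).
  rewrite (@inordK d (al i - be i)); last by apply: leq_ltn_trans h2; apply: leq_subr.
  by rewrite subnKC // inordK.
have E (ga : {ffun I -> 'I_d.+1}) : mle (addm (fun i => be i) (fun i => ga i)) d ->
    forall i, nat_of_ord ([ffun i => inord (be i + ga i) : 'I_d.+1] i) = (be i + ga i)%N.
  by move=> /forallP h i; rewrite ffunE inordK // ltnS; apply: h.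
apply: eq_big => [ga|ga /andP [h1 h2]].
  apply/andP/idP => [[/forallP h1 _]|h].
    apply/forallP => i; rewrite /addm; move: (h1 i); rewrite ffunE.
    case: (ltnP (be i + ga i) d.+1) => [|h _]; first by rewrite ltnS.
    (* [inord] sends an overflowing sum to 0; then [leqm] forces [be i = 0], and [ga i] alone cannot
       overflow. *)
    rewrite leqNgt; apply/negP => _; move: (h1 i); rewrite ffunE /inord val_insubd ltnNge h /=.
    by rewrite leqn0 => /eqP b0; move: h; rewrite b0 add0n leqNgt ltn_ord.
  split; first by apply/forallP => i; rewrite E // leq_addr.
  apply/eqP/ffunP => i; rewrite ffunE; apply/val_inj => /=.
  by rewrite E // addKn inordK.
congr (_ * v _); apply/funext => i; move/eqP/ffunP/(_ i): h2; rewrite ffunE /subm => <-.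
by rewrite inordK // ltnS (leq_trans (leq_subr _ _)) // -ltnS.
Qed.

Lemma bsumM d u v : bsum d u * bsum d v = bsum d (fun be => bsum d (fun ga => u be * v ga)).
Proof.
rewrite mulrC -bsumZ; apply: eq_bsum => be _; rewrite mulrC -bsumZ //.
Qed.

Lemma bsum_conv_le d u v : (forall al, 0 <= u al) -> (forall al, 0 <= v al) ->
  bsum d (conv u v) <= bsum d u * bsum d v.
Proof.
move=> u0 v0; rewrite bsum_conv bsumM; do 2!apply: ler_bsum => ? _.
by case: ifP => // _; rewrite mulr_ge0.
Qed.

Lemma bsum_conv_ge d u v : (forall al, 0 <= u al) -> (forall al, 0 <= v al) ->
  bsum d u * bsum d v <= bsum (d + d) (conv u v).
Proof.
move=> u0 v0; rewrite bsum_conv bsumM.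
apply: (@le_trans _ _ (bsum d (fun be => bsum (d + d)
    (fun ga => if mle (addm be ga) (d + d) then u be * v ga else 0)))); last first.
  apply: bsum_mono; last exact: leq_addr.
  by move=> al; apply: bsum_ge0 => be _; case: ifP => // _; rewrite mulr_ge0.
apply: ler_bsum => be hb.
apply: (@le_trans _ _ (bsum d
    (fun ga => if mle (addm be ga) (d + d) then u be * v ga else 0))).
  apply: ler_bsum => ga hg; rewrite (_ : mle _ _) //.
  apply/forallP => i; apply: leq_add; [exact: (forallP hb)|exact: (forallP hg)].
apply: bsum_mono; last exact: leq_addr.
by move=> ga; case: ifP => // _; rewrite mulr_ge0.
Qed.

(** Both differences run over the pairs in the box whose sum leaves it, so the bound holds term by
    term. *)
Lemma bsum_conv_diff d u v :
  `|bsum d u * bsum d v - bsum d (conv u v)| <=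
  bsum d (fun al => `|u al|) * bsum d (fun al => `|v al|)
   - bsum d (conv (fun al => `|u al|) (fun al => `|v al|)).
Proof.
rewrite !bsum_conv !bsumM -!sumrB.
apply: le_trans (ler_norm_sum _ _ _) _; apply: ler_sum => be _.
rewrite -!sumrB; apply: le_trans (ler_norm_sum _ _ _) _; apply: ler_sum => ga _.
by case: ifP => _; rewrite ?subrr ?normr0 // !subr0 normrM.
Qed.

Lemma conv_norm_le u v al :
  `|conv u v al| <= conv (fun al => `|u al|) (fun al => `|v al|) al.
Proof.
apply: le_trans (ler_norm_bsum _ _) _; apply: ler_bsum => be _.
by case: ifP => _; rewrite ?normr0 ?normrM.
Qed.

Definition mon (z : I -> R) al : R := \prod_i z i ^+ al i.

Lemma mon_split z al be : leqm be al -> mon z al = mon z be * mon z (subm al be).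
Proof.
move=> /forallP h; rewrite /mon -big_split /=; apply: eq_bigr => i _.
by rewrite -exprD subnKC.
Qed.

Lemma conv_mon z u v al :
  conv (fun al => u al * mon z al) (fun al => v al * mon z al) al = conv u v al * mon z al.
Proof.
rewrite mulrC /conv -bsumZ; apply: eq_bsum => be _.
case: ifP => [h|_]; last by rewrite mulr0.
by rewrite (mon_split z h) mulrACA mulrC.
Qed.

(** Cauchy's theorem on products of absolutely convergent series. For absolute values, the product
    of the sums over the box [d] lies between the Cauchy sums over the boxes [d] and [d + d], which
    share their limit; the signed defect is dominated by the defect of the absolute values. *)
Lemma bsum_cvg_conv u v (U V : R) (MU MV : R) :
  (forall d, bsum d (fun al => `|u al|) <= MU) ->
  (forall d, bsum d (fun al => `|v al|) <= MV) ->
  (bsum ^~ u @ \oo --> U) -> (bsum ^~ v @ \oo --> V) ->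
  (bsum ^~ (conv u v) @ \oo --> U * V).
Proof.
move=> hu hv cu cv.
pose u' := fun al => `|u al|; pose v' := fun al => `|v al|.
pose W := fun d => bsum d (conv u' v').
have u0 : forall al, 0 <= u' al by move=> al; exact: normr_ge0.
have v0 : forall al, 0 <= v' al by move=> al; exact: normr_ge0.
have W0 : forall al, 0 <= conv u' v' al.
  by move=> al; apply: bsum_ge0 => be _; case: ifP => // _; rewrite mulr_ge0.
have Wnd : nondecreasing_seq W by move=> m n mn; apply: bsum_mono.
have Wub : has_ubound (range W).
  exists (MU * MV) => _ [d _ <-]; apply: le_trans (bsum_conv_le _ u0 v0) _.
  by apply: ler_pM => //; apply: bsum_ge0.
have cW := nondecreasing_cvgn Wnd Wub; set w := sup _ in cW.
have cW2 : (fun d => W (d + d)%N) @ \oo --> w.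
  apply: cvg_comp cW.
  apply/cvgnyPge => A; near=> n; apply: leq_trans (leq_addr _ _).
  by near: n; exact: nbhs_infty_ge.
have cUV : (fun d => bsum d u' * bsum d v') @ \oo --> w.
  apply: (@squeeze_cvgr _ _ _ _ W (fun d => W (d + d)%N)) => //.
  by apply: nearW => d; rewrite bsum_conv_le // bsum_conv_ge.
have cdiff : (fun d => bsum d u * bsum d v - bsum d (conv u v)) @ \oo --> 0.
  apply/norm_cvg0P; apply: (@squeeze_cvgr _ _ _ _ (fun=> 0) (fun d => bsum d u' * bsum d v' - W d)).
  - by apply: nearW => d; rewrite normr_ge0 bsum_conv_diff.
  - exact: cvg_cst.
  - by rewrite -(subrr w); apply: cvgB.
have -> : bsum ^~ (conv u v) = (fun d => bsum d u * bsum d v - (bsum d u * bsum d v - bsum d (conv u v))).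
  by apply/funext => d; rewrite opprB addrC subrK.
by rewrite -[U * V]subr0; apply: cvgB => //; apply: cvgM.
Unshelve. all: by end_near. Qed.

End BoxSums.

(** * Absolutely convergent series at the origin *)

Section Germs.
Variables (R : realType) (I : finType).
Implicit Types (c e u v : (I -> nat) -> R) (al be : I -> nat) (d k : nat).
Implicit Types (f g : (I -> R) -> R) (z : I -> R).

Definition nrm (rho : R) c d := bsum d (fun al => `|c al| * mon (fun=> rho) al).

Definition psum c z d := bsum d (fun al => c al * mon z al).

(** [M] bounds a weighted l^1 norm, which is submultiplicative for [conv] and dominates all partial
    sums on the closed polydisc of radius [rho]. *)
Definition germ rho c M f := (forall d, nrm rho c d <= M) /\
  (forall z, (forall i, `|z i| <= rho) -> psum c z @ \oo --> f z).

Definition has_germ f := exists2 rho : R, 0 < rho & exists c M, germ rho c M f.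

Lemma mon_ge0 z al : (forall i, 0 <= z i) -> 0 <= mon z al.
Proof. by move=> z0; apply: prodr_ge0 => i _; rewrite exprn_ge0. Qed.

Lemma mon_norm_le (rho : R) z al : (forall i, `|z i| <= rho) ->
  `|mon z al| <= mon (fun=> rho) al.
Proof.
move=> h; rewrite /mon normr_prod; apply: ler_prod => i _.
by rewrite normr_ge0 /= normrX lerXn2r ?nnegrE // (le_trans _ (h i)).
Qed.

Lemma abs_psum_le (rho : R) c z d : (forall i, `|z i| <= rho) ->
  bsum d (fun al => `|c al * mon z al|) <= nrm rho c d.
Proof.
move=> h; apply: ler_bsum => al _; rewrite normrM ler_wpM2l //.
exact: mon_norm_le.
Qed.

Lemma nrm_ge0 rho c d : 0 <= rho -> 0 <= nrm rho c d.
Proof. by move=> r0; apply: bsum_ge0 => al _; rewrite mulr_ge0 // mon_ge0. Qed.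

Lemma nrm_le (rho rho' : R) c d : 0 <= rho' -> rho' <= rho -> nrm rho' c d <= nrm rho c d.
Proof.
move=> h1 h2; apply: ler_bsum => al _; rewrite ler_wpM2l //.
by apply: ler_prod => i _; rewrite exprn_ge0 //= lerXn2r ?nnegrE // (le_trans h1).
Qed.

Lemma germ_le (rho rho' : R) c M f : 0 < rho' -> rho' <= rho -> germ rho c M f ->
  germ rho' c M f.
Proof.
move=> h0 h [h1 h2]; split=> [d|z hz].
  by apply: le_trans (h1 d); apply: nrm_le => //; apply: ltW.
by apply: h2 => i; apply: le_trans h.
Qed.

(** Absolute convergence suffices because [t = (|t| + t) - |t|], and the box sums of a nonnegative
    family are monotone and here bounded. *)
Lemma psum_cvg (rho : R) c M z : (forall d, nrm rho c d <= M) ->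
  (forall i, `|z i| <= rho) -> exists l : R, psum c z @ \oo --> l.
Proof.
move=> hM hz.
pose t al := c al * mon z al.
have h1 : cvgn (fun d => bsum d (fun al => `|t al|)).
  apply: nondecreasing_is_cvgn; first by move=> m n mn; apply: bsum_mono.
  by exists M => _ [d _ <-]; apply: le_trans (abs_psum_le _ _ hz) _.
have h2 : cvgn (fun d => bsum d (fun al => `|t al| + t al)).
  have t0 al : 0 <= `|t al| + t al by rewrite -lerBlDr sub0r -normrN ler_norm.
  apply: nondecreasing_is_cvgn; first by move=> m n mn; apply: bsum_mono.
  exists (M + M) => _ [d _ <-].
  apply: (@le_trans _ _ (bsum d (fun al => `|t al| + `|t al|))).
    by apply: ler_bsum => al _; rewrite lerD2l ler_norm.
  by rewrite bsumD; apply: lerD; apply: le_trans (abs_psum_le _ _ hz) _.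
exists (lim ((fun d => bsum d (fun al => `|t al| + t al)) @ \oo)
   - lim ((fun d => bsum d (fun al => `|t al|)) @ \oo)).
have -> : psum c z = (fun d => bsum d (fun al => `|t al| + t al) - bsum d (fun al => `|t al|)).
  by apply/funext => d; rewrite bsumD addrC addKr.
exact: cvgB h2 h1.
Qed.

Lemma germ_common f g : has_germ f -> has_germ g ->
  exists2 rho : R, 0 < rho & exists c e M N, germ rho c M f /\ germ rho e N g.
Proof.
move=> [r1 r10 [c [M h1]]] [r2 r20 [e [N h2]]].
have r0 : 0 < Num.min r1 r2 by rewrite lt_min r10.
exists (Num.min r1 r2) => //; exists c, e, M, N.
by split; [apply: germ_le h1|apply: germ_le h2]; rewrite // ge_min lexx ?orbT.
Qed.

Lemma germ_eq rho c M f g : (forall z, (forall i, `|z i| <= rho) -> f z = g z) ->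
  germ rho c M f -> germ rho c M g.
Proof. by move=> e [h1 h2]; split=> // z hz; rewrite -e //; apply: h2. Qed.

Lemma germD rho c e M N f g : 0 < rho -> germ rho c M f -> germ rho e N g ->
  germ rho (fun al => c al + e al) (M + N) (fun z => f z + g z).
Proof.
move=> r0 [c1 c2] [e1 e2]; split=> [d|z hz].
  apply: (@le_trans _ _ (nrm rho c d + nrm rho e d)); last exact: lerD.
  rewrite -bsumD; apply: ler_bsum => al _; rewrite -mulrDl ler_wpM2r ?ler_normD //.
  by apply: mon_ge0 => _; apply: ltW.
have -> : psum (fun al => c al + e al) z = (fun d => psum c z d + psum e z d).
  by apply/funext => d; rewrite -bsumD; apply: eq_bsum => al _; rewrite mulrDl.
by apply: cvgD; [apply: c2|apply: e2].
Qed.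

Lemma germZ rho c M f (k : R) : germ rho c M f ->
  germ rho (fun al => k * c al) (`|k| * M) (fun z => k * f z).
Proof.
move=> [c1 c2]; split=> [d|z hz].
  have -> : nrm rho (fun al => k * c al) d = `|k| * nrm rho c d.
    by rewrite -bsumZ; apply: eq_bsum => al _; rewrite normrM mulrA.
  by rewrite ler_wpM2l.
have -> : psum (fun al => k * c al) z = (fun d => k * psum c z d).
  by apply/funext => d; rewrite -bsumZ; apply: eq_bsum => al _; rewrite mulrA.
by apply: cvgMr; apply: c2.
Qed.

Lemma nrm_conv rho c e d : 0 <= rho -> nrm rho (conv c e) d <= nrm rho c d * nrm rho e d.
Proof.
move=> r0.
have p u al : 0 <= `|u al| * mon (fun=> rho) al by rewrite mulr_ge0 // mon_ge0.
apply: le_trans (bsum_conv_le _ (p c) (p e)).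
apply: ler_bsum => al _; rewrite conv_mon ler_wpM2r ?conv_norm_le //.
exact: mon_ge0.
Qed.

Lemma germM rho c e M N f g : 0 < rho -> germ rho c M f -> germ rho e N g ->
  germ rho (conv c e) (M * N) (fun z => f z * g z).
Proof.
move=> r0 [c1 c2] [e1 e2]; split=> [d|z hz].
  apply: le_trans (nrm_conv _ _ _ (ltW r0)) _.
  by apply: ler_pM => //; apply: nrm_ge0; apply: ltW.
have -> : psum (conv c e) z =
    (fun d => bsum d (conv (fun al => c al * mon z al) (fun al => e al * mon z al))).
  by apply/funext => d; apply: eq_bsum => al _; rewrite conv_mon.
apply: (@bsum_cvg_conv _ _ _ _ _ _ M N); [| |exact: c2|exact: e2] => d.
- by apply: le_trans (c1 d); apply: abs_psum_le.
- by apply: le_trans (e1 d); apply: abs_psum_le.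
Qed.

Definition deg al := (\sum_i al i)%N.

Lemma deg0P al : deg al = 0%N -> al = fun=> 0%N.
Proof.
move=> h; apply/funext => i; apply/eqP; rewrite -leqn0 -h.
by rewrite /deg (bigD1 i) //= leq_addr.
Qed.

Lemma bsum0 c : bsum 0 c = c (fun=> 0%N).
Proof.
rewrite /bsum (bigD1 [ffun=> ord0]) //= big1 ?addr0; first by congr c; apply/funext => i; rewrite ffunE.
by move=> al /eqP h; case: h; apply/ffunP => i; rewrite ffunE; apply/val_inj; case: (al i) => [[]].
Qed.

Lemma psum_at0 c d : psum c (fun=> 0) d = c (fun=> 0%N).
Proof.
rewrite /psum (@bsum_widen _ _ 0) //.
  by rewrite bsum0 /mon big1 ?mulr1 // => i _; rewrite expr0.
move=> al /forallPn [i hi]; rewrite /mon (bigD1 i) //= expr0n.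
by move: hi; rewrite leqn0 => /negbTE ->; rewrite mul0r mulr0.
Qed.

Lemma germ_at0 rho c M f : 0 < rho -> germ rho c M f -> f (fun=> 0) = c (fun=> 0%N).
Proof.
move=> r0 [_ h]; have {}h : psum c (fun=> 0) @ \oo --> f (fun=> 0).
  by apply: h => i; rewrite normr0 ltW.
have -> : c (fun=> 0%N) = lim (psum c (fun=> 0) @ \oo).
  rewrite (_ : psum c _ = cst (c (fun=> 0%N))) ?lim_cst //.
  by apply/funext => d; rewrite psum_at0.
by apply/esym/cvg_lim.
Qed.

(** Without a constant term every monomial has degree at least 1 and yields a factor [t]; shrinking
    the polydisc thus makes the norm as small as desired. *)
Lemma nrm_scale (rho t : R) c d : 0 <= rho -> 0 <= t <= 1 -> c (fun=> 0%N) = 0 ->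
  nrm (t * rho) c d <= t * nrm rho c d.
Proof.
move=> r0 /andP [t0 t1] c0; rewrite -bsumZ; apply: ler_bsum => al _.
have [/deg0P ->|] := eqVneq (deg al) 0%N; first by rewrite c0 normr0 !mul0r mulr0.
rewrite -lt0n => dl.
have -> : mon (fun=> t * rho) al = t ^+ deg al * mon (fun=> rho) al.
  by rewrite /mon /deg; under eq_bigr do rewrite exprMn; rewrite big_split /= expr_sum.
rewrite mulrCA ler_wpM2r ?mulr_ge0 ?mon_ge0 //.
by case: (deg al) dl => // m _; rewrite exprS ler_piMr // exprn_ile1.
Qed.

Lemma germ_small rho c M f (eps : R) : 0 < rho -> 0 < eps -> c (fun=> 0%N) = 0 ->
  germ rho c M f -> exists2 r : R, 0 < r <= rho &
    forall r', 0 < r' <= r -> germ r' c eps f.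
Proof.
move=> r0 e0 c0 [h1 h2].
have M0 : 0 <= M by apply: le_trans (h1 0%N); apply: nrm_ge0; apply: ltW.
pose t : R := Num.min 1 (eps / (M + 1)).
have M1 : 0 < M + 1 by apply: ltr_wpDl.
have t0 : 0 < t by rewrite lt_min ltr01 divr_gt0.
have t1 : t <= 1 by rewrite ge_min lexx.
exists (t * rho); first by rewrite mulr_gt0 //= ler_piMl // ltW.
move=> r' /andP [r'0 r't]; split=> [d|z hz].
  apply: le_trans (nrm_le _ _ (ltW r'0) r't) _.
  apply: le_trans (nrm_scale _ (ltW r0) _ c0) _; first by rewrite t1 ltW.
  apply: (@le_trans _ _ (eps / (M + 1) * M)).
    apply: ler_pM => //; [exact: ltW|by apply: nrm_ge0; apply: ltW|].
    by rewrite ge_min lexx orbT.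
  by rewrite mulrAC ler_pdivrMr // ler_wpM2l ?ltW // ltrDl.
by apply: h2 => i; apply: le_trans (hz i) (le_trans r't _); rewrite ler_piMl // ltW.
Qed.

Lemma germ_const rho (k : R) : 0 < rho ->
  germ rho (fun al => if deg al == 0%N then k else 0) `|k| (fun=> k).
Proof.
move=> r0.
have E z d : psum (fun al => if deg al == 0%N then k else 0) z d = k.
  rewrite /psum (@bsum_widen _ _ 0) //.
    by rewrite bsum0 /deg /mon !big1 ?mulr1 ?eqxx // => i _; rewrite expr0.
  move=> al /forallPn [i]; rewrite -ltnNge => hi; rewrite ifF ?mul0r //.
  by apply/negbTE; rewrite -lt0n /deg (bigD1 i) //= (leq_trans hi) // leq_addr.
split=> [d|z _]; last first.
  rewrite (_ : psum _ z = cst k); first exact: cvg_cst.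
  by apply/funext => d; rewrite E.
rewrite /nrm (@bsum_widen _ _ 0) //.
  by rewrite bsum0 /deg /mon !big1 ?mulr1 ?eqxx // => i _; rewrite expr0.
move=> al /forallPn [i]; rewrite -ltnNge => hi; rewrite ifF ?normr0 ?mul0r //.
by apply/negbTE; rewrite -lt0n /deg (bigD1 i) //= (leq_trans hi) // leq_addr.
Qed.

Section QuadraticFixpoint.
Variables (g : R) (A B : (I -> nat) -> R).
Hypotheses (A0 : A (fun=> 0%N) = 0) (B0 : B (fun=> 0%N) = 0).

(** Picard iterates, from 0, of [b = A + (B + g b) b] on coefficients. As [A] and [B] have no
    constant term, the coefficient of index [al] is stationary from step [deg al] on, whence
    [bfix]. *)
Fixpoint bk k : (I -> nat) -> R :=
  if k is k'.+1 then fun al => A al + conv (fun be => B be + g * bk k' be) (bk k') al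
  else fun=> 0.

Lemma bk0 k : bk k (fun=> 0%N) = 0.
Proof.
elim: k => //= k IH; rewrite A0 add0r (@conv_box _ _ 0); last by apply/forallP.
by rewrite bsum0 B0 IH !(mulr0, addr0, mul0r); case: ifP.
Qed.

Lemma deg_subm al be : leqm be al -> (deg be + deg (subm al be) = deg al)%N.
Proof.
by move=> /forallP h; rewrite /deg -big_split /=; apply: eq_bigr => i _; rewrite subnKC.
Qed.

(* In the convolution, the factors of full degree meet a vanishing constant term. *)
Lemma bk_stable k al : (deg al <= k)%N -> bk k al = bk k.+1 al.
Proof.
elim: k al => [al|k IH al hal].
  by rewrite leqn0 => /eqP /deg0P ->; rewrite !bk0.
rewrite -[LHS]/(A al + conv (fun be => B be + g * bk k be) (bk k) al).
rewrite -[RHS]/(A al + conv (fun be => B be + g * bk k.+1 be) (bk k.+1) al).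
congr (_ + _); apply: eq_bsum => be _; case: ifP => // hbe.
have hd := deg_subm hbe.
have [/deg0P b0|b0] := eqVneq (deg be) 0%N; first by rewrite b0 B0 !bk0 mulr0 addr0 !mul0r.
have [/deg0P b1|b1] := eqVneq (deg (subm al be)) 0%N; first by rewrite b1 !bk0 !mulr0.
have h1 : (deg be <= k)%N by lia.
have h2 : (deg (subm al be) <= k)%N by lia.
by rewrite (IH be) // (IH (subm al be)).
Qed.

Definition bfix al := bk (deg al) al.

Lemma bfixE k al : (deg al <= k)%N -> bk k al = bfix al.
Proof.
move=> h; rewrite -(subnKC h); elim: (k - deg al)%N => [|m IH]; first by rewrite addn0.
by rewrite addnS -bk_stable // leq_addr.
Qed.

Lemma bfix_eq al : bfix al = A al + conv (fun be => B be + g * bfix be) bfix al.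
Proof.
rewrite -(@bfixE (deg al).+1) //=; congr (_ + _).
have E be : leqm be al -> bk (deg al) be = bfix be.
  by move=> /deg_subm h; apply: bfixE; rewrite -h leq_addr.
by apply: conv_eq => be h; rewrite E.
Qed.

(** The ball of radius 1/2 is preserved because 1/4 + (1/4 + 1/2 * 1/2) * 1/2 = 1/2. *)
Lemma nrm_bk rho k d : 0 < rho -> `|g| <= 2^-1 -> nrm rho A d <= 4^-1 -> nrm rho B d <= 4^-1 ->
  nrm rho (bk k) d <= 2^-1.
Proof.
move=> r0 hg hA hB; elim: k => [|k IH].
  by rewrite /nrm /bsum big1 ?invr_ge0 // => al _; rewrite normr0 mul0r.
have nD c e : nrm rho (fun al => c al + e al) d <= nrm rho c d + nrm rho e d.
  rewrite -bsumD; apply: ler_bsum => al _; rewrite -mulrDl ler_wpM2r ?ler_normD //.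
  by apply: mon_ge0 => _; apply: ltW.
rewrite /=; apply: le_trans (nD _ _) _.
have h1 := nrm_conv (fun be => B be + g * bk k be) (bk k) d (ltW r0).
have h2 := nD B (fun be => g * bk k be).
have h3 : nrm rho (fun be => g * bk k be) d = `|g| * nrm rho (bk k) d.
  by rewrite -bsumZ; apply: eq_bsum => al _; rewrite normrM mulrA.
have p1 := nrm_ge0 (bk k) d (ltW r0).
have p2 := nrm_ge0 (fun be => B be + g * bk k be) d (ltW r0).
have h4 : `|g| * nrm rho (bk k) d <= 2^-1 * 2^-1 by apply: ler_pM.
have h5 : nrm rho (fun be => B be + g * bk k be) d * nrm rho (bk k) d <= 2^-1 * 2^-1.
  by apply: ler_pM => //; lra.
lra.
Qed.

End QuadraticFixpoint.

(* g = 0 gives inverses and g = -1/2 gives square roots. *)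
Lemma germ_fix rho (g : R) A B fA fB : 0 < rho -> `|g| <= 2^-1 ->
  A (fun=> 0%N) = 0 -> B (fun=> 0%N) = 0 ->
  germ rho A 4^-1 fA -> germ rho B 4^-1 fB ->
  exists c f, germ rho c 2^-1 f /\ forall z, (forall i, `|z i| <= rho) ->
    f z = fA z + (fB z + g * f z) * f z /\ `|f z| <= 2^-1.
Proof.
move=> r0 hg A0 B0 gA gB.
have nb d : nrm rho (bfix g A B) d <= 2^-1.
  (* In the box of side [d] all degrees are at most [#|I| * d], so this iterate already agrees with
     the fixed point there. *)
  apply: le_trans (nrm_bk (#|I| * d) r0 hg (gA.1 d) (gB.1 d)).
  rewrite le_eqVlt; apply/orP; left; apply/eqP; apply: eq_bsum => al /forallP hal.
  rewrite bfixE // /deg -sum1_card big_distrl /=.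
  by apply: leq_sum => i _; rewrite mul1n.
have [f hf] : {f : (I -> R) -> R & forall z, (forall i, `|z i| <= rho) ->
    psum (bfix g A B) z @ \oo --> f z}.
  exists (fun z => lim (psum (bfix g A B) z @ \oo)) => z hz.
  by have [l hl] := psum_cvg nb hz; rewrite (cvg_lim _ hl).
have gf : germ rho (bfix g A B) 2^-1 f by split.
exists (bfix g A B), f; split => // z hz; split.
  have h := germD r0 gA (germM r0 (germD r0 gB (germZ g gf)) gf).
  have := h.2 z hz.
  have -> : psum (fun al => A al + conv (fun al => B al + g * bfix g A B al) (bfix g A B) al) z
     = psum (bfix g A B) z.
    by apply/funext => d; apply: eq_bsum => al _; rewrite -bfix_eq.
  by move=> h'; apply: (cvg_unique _ (hf z hz) h').
apply: (ler_cvg_to (cvg_norm (hf z hz)) (cvg_cst (2^-1 : R))).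
apply: nearW => d; apply: le_trans (nb d).
exact: le_trans (ler_norm_bsum _ _) (abs_psum_le _ _ hz).
Qed.

End Germs.

Section GermClosure.
Variables (R : realType) (I : finType).
Implicit Types (f g : (I -> R) -> R) (z : I -> R).

Lemma has_germ_const (k : R) : has_germ (fun _ : I -> R => k).
Proof.
by exists 1 => //; exists (fun al => if deg al == 0%N then k else 0), `|k|; apply: germ_const.
Qed.

Lemma has_germD f g : has_germ f -> has_germ g -> has_germ (fun z => f z + g z).
Proof.
move=> hf hg; have [r r0 [c [e [M [N [h1 h2]]]]]] := germ_common hf hg.
by exists r => //; eexists; eexists; apply: germD h1 h2.
Qed.

Lemma has_germM f g : has_germ f -> has_germ g -> has_germ (fun z => f z * g z).
Proof.
move=> hf hg; have [r r0 [c [e [M [N [h1 h2]]]]]] := germ_common hf hg.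
by exists r => //; eexists; eexists; apply: germM h1 h2.
Qed.

Lemma has_germ_small f (eps : R) : 0 < eps -> has_germ f -> f (fun=> 0) = 0 ->
  exists2 rho : R, 0 < rho & exists2 c, c (fun=> 0%N) = 0 &
    forall r', 0 < r' <= rho -> germ r' c eps f.
Proof.
move=> e0 [r r0 [c [M hc]]] f0.
have c0 : c (fun=> 0%N) = 0 by rewrite -(germ_at0 r0 hc).
have [r' /andP [r'0 _] h] := germ_small r0 e0 c0 hc.
by exists r' => //; exists c.
Qed.

Lemma has_germ_near f (eps : R) : 0 < eps -> has_germ f ->
  exists2 r : R, 0 < r & forall z, (forall i, `|z i| <= r) -> `|f z - f (fun=> 0)| <= eps.
Proof.
move=> e0 hf.
have hg : has_germ (fun z => f z + (- f (fun=> 0))) by apply: has_germD => //; apply: has_germ_const.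
have [r r0 [c _ h]] := has_germ_small e0 hg (subrr _).
exists r => // z hz; have [|h1 h2] := h r; first by rewrite r0 lexx.
apply: (ler_cvg_to (cvg_norm (h2 z hz)) (cvg_cst (eps : R))).
apply: nearW => d; apply: le_trans (h1 d).
exact: le_trans (ler_norm_bsum _ _) (abs_psum_le _ _ hz).
Qed.

(** For [A = B = 1 - f / v] and [g = 0] the equation reads [b = A (1 + b)], so that
    [1 + b = 1 / (1 - A) = v / f]. *)
Lemma has_germV f : has_germ f -> f (fun=> 0) != 0 -> has_germ (fun z => (f z)^-1).
Proof.
move=> hf f0; set v := f _ in f0.
have e4 : 0 < 4^-1 :> R by rewrite invr_gt0.
have hA : has_germ (fun z => 1 + (- v^-1) * f z).
  by apply: has_germD; [|apply: has_germM]; rewrite //; apply: has_germ_const.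
have [|r r0 [c c0 h]] := has_germ_small e4 hA; first by rewrite mulNr mulVf // subrr.
have {}h : germ r c 4^-1 (fun z => 1 + (- v^-1) * f z) by apply: h; rewrite r0 lexx.
have [|b [be [hb E]]] := germ_fix r0 _ c0 c0 h h (g := 0).
  by rewrite normr0 invr_ge0.
have h2 := germZ v^-1 (germD r0 (germ_const I 1 r0) hb).
exists r => //; eexists; eexists; apply: germ_eq h2 => z hz /=.
have [E1 _] := E z hz.
have E2 : (1 + be z) * f z = v.
  apply: (mulIf (invr_neq0 f0)); rewrite mulfV //.
  have : be z * (v^-1 * f z) = 1 - v^-1 * f z by move: E1; set w := v^-1 * f z; rewrite mulNr -/w; lra.
  by move=> h3; rewrite mulrDl mul1r mulrDl -mulrA [f z * _]mulrC h3; lra.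
have fz0 : f z != 0 by apply: contra_neq f0 => fz; rewrite -E2 fz mulr0.
by apply: (mulIf fz0); rewrite mulVf // -mulrA E2 mulVf.
Qed.

(** For [A = (f / v - 1) / 2], [B = 0] and [g = -1/2] the equation reads [(1 + b)^2 = f / v], and
    [|b| <= 1/2] makes [1 + b] the positive root. *)
Lemma has_germ_sqrt f : has_germ f -> 0 < f (fun=> 0) -> has_germ (fun z => Num.sqrt (f z)).
Proof.
move=> hf f0; set v := f _ in f0.
have e4 : 0 < 4^-1 :> R by rewrite invr_gt0.
have v0 : v != 0 by rewrite gt_eqF.
have hA : has_germ (fun z => - 2^-1 + (2^-1 * v^-1) * f z).
  by apply: has_germD; [|apply: has_germM]; rewrite //; apply: has_germ_const.
have [|r1 r10 [c c0 h]] := has_germ_small e4 hA; first by rewrite -mulrA mulVf // mulr1 addNr.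
have [|r2 r20 [c' c'0 h']] := has_germ_small e4 (has_germ_const 0); first by [].
pose r := Num.min r1 r2.
have r0 : 0 < r by rewrite lt_min r10.
have {}h : germ r c 4^-1 (fun z => - 2^-1 + (2^-1 * v^-1) * f z).
  by apply: h; rewrite r0 ge_min lexx.
have {}h' : germ r c' 4^-1 (fun z : I -> R => 0).
  by apply: h'; rewrite r0 ge_min lexx orbT.
have [|b [be [hb E]]] := germ_fix r0 _ c0 c'0 h h' (g := - 2^-1).
  by rewrite normrN ger0_norm // invr_ge0.
have h2 := germZ (Num.sqrt v) (germD r0 (germ_const I 1 r0) hb).
exists r => //; eexists; eexists; apply: germ_eq h2 => z hz /=.
have [E1 E2] := E z hz.
have b0 : 0 <= 1 + be z by move: E2; rewrite ler_norml => /andP [h1 _]; lra.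
have E3 : (1 + be z) ^+ 2 = v^-1 * f z.
  by move: E1; rewrite -mulrA; set w := v^-1 * f z; move: (be z) => b'; nra.
have -> : f z = v * (1 + be z) ^+ 2 by rewrite E3 mulrA mulfV // mul1r.
by rewrite sqrtrM ?ltW // sqrtr_sqr ger0_norm.
Qed.

End GermClosure.

(** * Analytic functions of a matrix *)

Section AnalyticFunctions.
Variables (R : realType) (a b : nat).
Implicit Types (f g : 'M[R]_(a, b) -> R) (x y : 'M[R]_(a, b)).

Definition shift_mx x (z : 'I_a * 'I_b -> R) : 'M[R]_(a, b) := \matrix_(i, j) (x i j + z (i, j)).

Definition analytic_at f x := has_germ (fun z => f (shift_mx x z)).

Lemma shift_mx0 x : shift_mx x (fun=> 0) = x.
Proof. by apply/matrixP => i j; rewrite mxE addr0. Qed.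

Lemma shift_mxB x y : shift_mx x (fun ij => y ij.1 ij.2 - x ij.1 ij.2) = y.
Proof. by apply/matrixP => i j; rewrite mxE /= addrC subrK. Qed.

Lemma monomE x y al : monom x y al = mon (fun ij => y ij.1 ij.2 - x ij.1 ij.2) al.
Proof. by rewrite /monom pair_bigA /=; apply: eq_bigr => -[]. Qed.

Lemma box_sumE c x y d : box_sum c x y d = psum c (fun ij => y ij.1 ij.2 - x ij.1 ij.2) d.
Proof. by apply: eq_bigr => al _; rewrite monomE. Qed.

Lemma analytic_fun_onP (U : set 'M[R]_(a, b)) f :
  analytic_fun_on U f <-> open U /\ forall x, U x -> analytic_at f x.
Proof.
split=> -[oU h]; split=> // x Ux.
  have [r [r0 [c hc]]] := h x Ux.
  have r20 : 0 < r / 2 by rewrite divr_gt0.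
  have r2r : r / 2 < r by rewrite ltr_pdivrMr // ltr_pMr // ltr1n.
  (* At the corner of the polydisc of radius [r / 2] the absolute sums are the weighted norm itself,
     so the bound at this one point is a bound for the whole closed polydisc. *)
  have [|[B hB] _] := hc (shift_mx x (fun=> r / 2)).
    by move=> i j; rewrite mxE addrC addKr ger0_norm // ltW.
  exists (r / 2) => //; exists c, B; split=> [d|z hz].
    apply: le_trans (hB d); apply: ler_sum => al _.
    rewrite normrM monomE ler_wpM2l // le_eqVlt; apply/orP; left; apply/eqP.
    rewrite ger0_norm; last by apply: mon_ge0 => i; rewrite mxE addrC addKr ltW.
    by congr mon; apply/funext => ij; rewrite mxE addrC addKr.
  have [|_] := hc (shift_mx x z).
    by move=> i j; rewrite mxE addrC addKr; apply: le_lt_trans r2r.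
  rewrite (_ : psum c z = box_sum c x (shift_mx x z)) //.
  apply/funext => d; rewrite box_sumE; congr psum.
  by apply/funext => -[i j]; rewrite mxE /= addrC addKr.
have [r r0 [c [M [h1 h2]]]] := h x Ux.
exists r; split=> //; exists c => y hy.
have hz : forall ij : 'I_a * 'I_b, `|y ij.1 ij.2 - x ij.1 ij.2| <= r by move=> ij; apply: ltW.
split.
  exists M => d; apply: le_trans (h1 d); apply: le_trans (abs_psum_le _ _ hz).
  by apply: ler_sum => al _; rewrite monomE.
have := h2 _ hz; rewrite shift_mxB.
by rewrite (_ : psum c _ = box_sum c x y) //; apply/funext => d; rewrite box_sumE.
Qed.

Lemma analytic_at_coord i j x : analytic_at (fun y => y i j) x.
Proof.
rewrite /analytic_at.
have -> : (fun z => shift_mx x z i j) = (fun z : 'I_a * 'I_b -> R => x i j + z (i, j)).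
  by apply/funext => z; rewrite mxE.
apply: has_germD; first exact: has_germ_const.
pose e : 'I_a * 'I_b -> nat := fun ij => (ij == (i, j) : nat).
pose c (al : 'I_a * 'I_b -> nat) : R := if `[< al = e >] then 1 else 0.
have me (z : 'I_a * 'I_b -> R) : mon z e = z (i, j).
  rewrite /mon (bigD1 (i, j)) //= big1 ?mulr1 /e ?eqxx ?expr1 //.
  by move=> ij /negbTE ->; rewrite expr0.
have E d (F : ('I_a * 'I_b -> nat) -> R) : (0 < d)%N -> bsum d (fun al => if `[< al = e >] then F al else 0) = F e.
  move=> d0; rewrite /bsum (bigD1 [ffun ij => inord (e ij)]) //=.
  have Ee : (fun i0 => nat_of_ord ([ffun ij => inord (e ij) : 'I_d.+1] i0)) = e.
    by apply/funext => ij; rewrite ffunE inordK // ltnS (leq_trans _ d0) // /e; case: eqP.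
  rewrite Ee; case: asboolP => // _; rewrite big1 ?addr0 // => al /eqP hal.
  case: asboolP => // h; case: hal; apply/ffunP => ij; apply/val_inj.
  by rewrite ffunE /= -h inord_val.
(* The box of side 0 contains only the zero exponent; the partial sums take their final value from
   [d = 1] on. *)
have E0 (F : ('I_a * 'I_b -> nat) -> R) : bsum 0 (fun al => if `[< al = e >] then F al else 0) = 0.
  rewrite bsum0; case: asboolP => // /(congr1 (fun h => h (i, j))).
  by rewrite /e eqxx.
have Ez z d : psum c z d = bsum d (fun al => if `[< al = e >] then mon z al else 0).
  by apply: eq_bsum => al _; rewrite /c; case: asboolP; rewrite ?mul1r ?mul0r.
exists 1 => //; exists c, 1; split=> [d|z hz].
  have -> : nrm 1 c d = bsum d (fun al => if `[< al = e >] then mon (fun=> 1) al else 0).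
    by apply: eq_bsum => al _; rewrite /c; case: asboolP; rewrite ?normr1 ?normr0 ?mul1r ?mul0r.
  by case: d => [|d]; rewrite ?E0 // E // me.
apply: cvg_near_cst; near=> d; rewrite Ez E ?me //; near: d; exact: nbhs_infty_gt.
Unshelve. all: by end_near. Qed.

Lemma analytic_at_cont f x : analytic_at f x -> {for x, continuous f}.
Proof.
move=> hf; apply/(@cvgrPdist_le _ _ _ (nbhs x) _) => eps e0.
have [r r0 h] := has_germ_near e0 hf; rewrite shift_mx0 in h.
apply/nbhs_ballP; exists r => //= y hy.
rewrite distrC -(shift_mxB x y); apply: h => -[i j] /=.
by case: hy => _ /(_ i j); rewrite /ball /= distrC => /ltW.
Qed.

End AnalyticFunctions.

(** * Triangular linkages and their configurations *)

Section Vectors.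
Variables (R : realType) (n : nat).
Implicit Types (u v w : 'rV[R]_n).

Definition dot u v : R := \sum_j u ord0 j * v ord0 j.
Definition nq u : R := dot u u.

Lemma dotC u v : dot u v = dot v u.
Proof. by apply: eq_bigr => j _; rewrite mulrC. Qed.
Lemma dotDl u v w : dot (u + v) w = dot u w + dot v w.
Proof. by rewrite /dot -big_split; apply: eq_bigr => j _; rewrite mxE mulrDl. Qed.
Lemma dotDr u v w : dot w (u + v) = dot w u + dot w v.
Proof. by rewrite dotC dotDl !(dotC w). Qed.
Lemma dotZl (k : R) u w : dot (k *: u) w = k * dot u w.
Proof. by rewrite /dot mulr_sumr; apply: eq_bigr => j _; rewrite mxE mulrA. Qed.
Lemma dotZr (k : R) u w : dot w (k *: u) = k * dot w u.
Proof. by rewrite dotC dotZl dotC. Qed.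
Lemma dotNl u w : dot (- u) w = - dot u w.
Proof. by rewrite -scaleN1r dotZl mulN1r. Qed.
Lemma dotNr u w : dot w (- u) = - dot w u.
Proof. by rewrite dotC dotNl dotC. Qed.
Lemma dot0l w : dot 0 w = 0.
Proof. by rewrite -(scale0r 0) dotZl mul0r. Qed.
Lemma dot0r w : dot w 0 = 0.
Proof. by rewrite dotC dot0l. Qed.
Definition dotE := (dotDl, dotDr, dotZl, dotZr, dotNl, dotNr, dot0l, dot0r).

Lemma nq_ge0 u : 0 <= nq u.
Proof. by apply: sumr_ge0 => j _; rewrite -expr2 sqr_ge0. Qed.

Lemma nq_eq0 u : nq u = 0 -> u = 0.
Proof.
move=> h; apply/rowP => j; rewrite mxE.
have /eqP := h; rewrite psumr_eq0; last by move=> k _; rewrite -expr2 sqr_ge0.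
by move=> /allP /(_ j); rewrite mem_index_enum => /(_ isT) /=; rewrite -expr2 sqrf_eq0 => /eqP.
Qed.

Lemma edist_nq u v : Defs.edist u v = Num.sqrt (nq (u - v)).
Proof. by congr Num.sqrt; apply: eq_bigr => j _; rewrite !mxE expr2. Qed.

(** A degenerate triangle is rigid in every dimension: the distances force [dot w u = k * c], which
    leaves no component of [w] off the line of [u]. Bars alone can therefore impose a scaling. *)
Lemma collinear_unique (k c : R) u w : nq u = c ->
  nq w = k ^+ 2 * c -> nq (w - u) = (k - 1) ^+ 2 * c -> w = k *: u.
Proof.
rewrite /nq !dotE (dotC u w) => hu hw hwu; apply/eqP; rewrite -subr_eq0; apply/eqP/nq_eq0.
rewrite /nq !dotE (dotC u w); have : dot w u = k * c by lra.
by move=> ->; rewrite hu hw; ring.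
Qed.

End Vectors.

Fixpoint alls (A : Type) (P : A -> Prop) (s : seq A) : Prop :=
  if s is x :: s' then P x /\ alls P s' else True.

Lemma alls_mem (A : eqType) (P : A -> Prop) (s : seq A) :
  alls P s <-> forall x, x \in s -> P x.
Proof.
elim: s => [|y s IH] /=; first by split.
rewrite IH; split=> [[h1 h2] x|h].
  by rewrite inE => /orP [/eqP ->|]; [|apply: h2].
by split; [apply: h; rewrite mem_head|move=> x hx; apply: h; rewrite inE hx orbT].
Qed.

Lemma alls_impl (A : Type) (P Q : A -> Prop) (s : seq A) :
  (forall x, P x -> Q x) -> alls P s -> alls Q s.
Proof. by move=> h; elim: s => //= x s IH [h1 h2]; split; [apply: h|apply: IH]. Qed.

Lemma eq_alls_in (A : Type) (P Q C : A -> Prop) (s : seq A) :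
  (forall x, C x -> (P x <-> Q x)) -> alls C s -> (alls P s <-> alls Q s).
Proof.
by move=> h; elim: s => //= x s IH [c1 c2]; rewrite (IH c2) (h _ c1).
Qed.

Lemma alls_cat (A : Type) (P : A -> Prop) (s t : seq A) :
  alls P (s ++ t) <-> alls P s /\ alls P t.
Proof. by elim: s => [|x s IH] /=; [tauto|rewrite IH; tauto]. Qed.

Lemma alls_map (A B : Type) (P : B -> Prop) (f : A -> B) (s : seq A) :
  alls P (map f s) <-> alls (fun x => P (f x)) s.
Proof. by elim: s => //= x s ->. Qed.

(** * Linkages built vertex by vertex *)

Section Builder.
Variables (R : realType) (n : nat) (T : Type).
Notation V := 'rV[R]_n.

(* Vertex number i carries its prescribed position, if it is a fixed vertex,
   and its edges (j, length, flexible?) to vertices j < i. *)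
Definition vtx := (option V * seq (nat * R * bool))%type.

Definition cmp (b : bool) (x y : R) : Prop := if b then is_true (x <= y) else x = y.

Definition vtx_ok (phi : nat -> V) i (w : vtx) :=
  (forall z, w.1 = Some z -> phi i = z) /\
  alls (fun e : nat * R * bool => cmp e.2 (nq (phi i - phi e.1.1)) (e.1.2 ^+ 2)) w.2.

Fixpoint satf N (ws : seq vtx) phi : Prop :=
  if ws is w :: ws' then vtx_ok phi N w /\ satf N.+1 ws' phi else True.

Fixpoint wff N (ws : seq vtx) : Prop :=
  if ws is w :: ws' then
    [/\ uniq [seq e.1.1 | e <- w.2], alls (fun e : nat * R * bool => (e.1.1 < N)%N /\ 0 < e.1.2) w.2 & wff N.+1 ws']
  else True.

Lemma satf_cat N ws ws' phi :
  satf N (ws ++ ws') phi <-> satf N ws phi /\ satf (N + size ws) ws' phi.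
Proof.
elim: ws N => [|w ws IH] N /=; first by rewrite addn0; tauto.
by rewrite IH addSnnS; tauto.
Qed.

Lemma wff_cat N ws ws' : wff N ws -> wff (N + size ws) ws' -> wff N (ws ++ ws').
Proof.
elim: ws N => [|w ws IH] N /=; first by rewrite addn0.
by case=> h1 h2 h3 h4; split=> //; apply: IH; rewrite // addSnnS.
Qed.

Record st := St { vs : seq vtx; fs : seq (T -> V) }.
Definition sz S := size (vs S).
Definition fn S i : T -> V := nth (fun=> 0) (fs S) i.

Variable nice : (T -> R) -> Prop.
Definition vnice (f : T -> V) := forall j, nice (fun u => f u ord0 j).

(** The configurations are exactly the images of the parameters in [D]. Injectivity of the
    parametrisation is not part of the invariant: the inverse of the input map comes from the given
    inverse of [q]. *)
Definition good (D : T -> Prop) S :=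
  [/\ size (fs S) = sz S, wff 0 (vs S), (forall i, (i < sz S)%N -> vnice (fn S i)) &
    forall phi, satf 0 (vs S) phi <-> exists u, D u /\ forall i, (i < sz S)%N -> phi i = fn S i u].

Definition ext S S' := exists ws gs, vs S' = vs S ++ ws /\ fs S' = fs S ++ gs.

Lemma ext_refl S : ext S S.
Proof. by exists [::], [::]; rewrite !cats0. Qed.

Lemma ext_trans S1 S2 S3 : ext S1 S2 -> ext S2 S3 -> ext S1 S3.
Proof.
move=> [w [g [a b]]] [w' [g' [c d]]]; exists (w ++ w'), (g ++ g').
by rewrite c a d b !catA.
Qed.

Lemma ext_sz S S' : ext S S' -> (sz S <= sz S')%N.
Proof. by move=> [w [g [h _]]]; rewrite /sz h size_cat leq_addr. Qed.

Lemma ext_fn D S S' i : good D S -> ext S S' -> (i < sz S)%N -> fn S' i = fn S i.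
Proof.
by move=> [h _ _ _] [w [g [_ E]]] hi; rewrite /fn E nth_cat h hi.
Qed.

(** The parameter may be replaced by another one with the same old vertices: so a free variable
    enters, as a coordinate on which no old vertex depends. Passing from [D] to [D'] lets
    constraints enter. *)
Lemma good_cat D D' S ws gs : good D S -> size gs = size ws -> wff (sz S) ws ->
  (forall i, (i < size ws)%N -> vnice (nth (fun=> 0) gs i)) ->
  (forall u, D' u -> D u) ->
  (forall phi u, D u -> (forall i, (i < sz S)%N -> phi i = fn S i u) ->
    (satf (sz S) ws phi <-> exists u', [/\ D' u', (forall i, (i < sz S)%N -> fn S i u' = fn S i u)
       & forall i, (i < size ws)%N -> phi (sz S + i)%N = nth (fun=> 0) gs i u'])) ->
  good D' (St (vs S ++ ws) (fs S ++ gs)).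
Proof.
move=> [h1 h2 h3 h4] hs hw hg hD h; split; rewrite /sz /=.
- by rewrite !size_cat h1 hs.
- by apply: wff_cat.
- move=> i; rewrite size_cat /fn /= nth_cat h1 -/(sz S) => hi.
  by case: ltnP => hi'; [apply: h3|apply: hg; lia].
move=> phi; rewrite satf_cat add0n; split.
  move=> [/h4 [u [Du hu]] /(h _ _ Du hu) [u' [D'u' e1 e2]]].
  exists u'; split=> // i; rewrite size_cat /fn /= nth_cat h1 -/(sz S) => hi.
  case: ltnP => hi'; first by rewrite hu // -e1.
  by rewrite -e2; [congr phi|]; lia.
move=> [u [Du hu]].
have hu1 i : (i < sz S)%N -> phi i = fn S i u.
  by move=> hi; rewrite hu ?size_cat ?ltn_addr // /fn /= nth_cat h1 hi.
split; first by apply/h4; exists u; split=> //; apply: hD.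
apply/(h phi u (hD _ Du)) => //; exists u; split=> // i hi.
rewrite hu ?size_cat ?ltn_add2l // /fn /= nth_cat h1 -/(sz S).
by rewrite ltnNge leq_addr /= addKn.
Qed.

Lemma good_add D D' S (w : vtx) g : good D S ->
  uniq [seq e.1.1 | e <- w.2] -> alls (fun e : nat * R * bool => (e.1.1 < sz S)%N /\ 0 < e.1.2) w.2 ->
  vnice g -> (forall u, D' u -> D u) ->
  (forall u W, D u ->
    ((forall z, w.1 = Some z -> W = z) /\
      alls (fun e : nat * R * bool => cmp e.2 (nq (W - fn S e.1.1 u)) (e.1.2 ^+ 2)) w.2 <->
     exists u', [/\ D' u', (forall i, (i < sz S)%N -> fn S i u' = fn S i u) & W = g u'])) ->
  good D' (St (rcons (vs S) w) (rcons (fs S) g)).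
Proof.
move=> gS hu hl hg hD h; rewrite -!cats1; apply: (good_cat gS) => //=.
  by case.
move=> phi u Du hphi.
have E : alls (fun e : nat * R * bool => cmp e.2 (nq (phi (sz S) - phi e.1.1)) (e.1.2 ^+ 2)) w.2 <->
         alls (fun e : nat * R * bool => cmp e.2 (nq (phi (sz S) - fn S e.1.1 u)) (e.1.2 ^+ 2)) w.2.
  by apply: (eq_alls_in _ hl) => e [he _]; rewrite (hphi e.1.1) //; tauto.
rewrite /vtx_ok E; split.
  move=> [/(h _ _ Du) [u' [D'u' e1 e2]] _]; exists u'; split=> //.
  by case=> // _; rewrite addn0.
move=> [u' [D'u' e1 e2]]; split=> //; apply/(h _ _ Du); exists u'; split=> //.
by have := e2 0%N; rewrite addn0; apply.
Qed.

(** The last clause says that the auxiliary vertices depend on no more than [g u]; [variables_state]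
    uses it to know which coordinates each vertex sees. *)
Definition new_vertex (D : T -> Prop) S g S' :=
  [/\ ext S S', good D S',
     exists i, [/\ (sz S <= i)%N, (i < sz S')%N & forall u, fn S' i u = g u] &
     forall i u u', (sz S <= i)%N -> g u = g u' -> fn S' i u = fn S' i u'].

Hypothesis nice_const : forall k : R, nice (fun=> k).

Lemma add_fixed D S (z : V) : good D S -> exists S', [/\ ext S S', good D S',
  sz S' = (sz S).+1 & forall u, fn S' (sz S) u = z].
Proof.
move=> gS; exists (St (rcons (vs S) (Some z, [::])) (rcons (fs S) (fun=> z))); split.
- by exists [:: (Some z, [::])], [:: fun=> z]; rewrite !cats1.
- apply: good_add gS _ _ _ _ _ => //= u W Du.
  split=> [[h _]|[u' [_ _ ->]]]; last by split=> // z' [].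
  by exists u; split=> //; apply: h.
- by rewrite /sz /= size_rcons.
- by move=> u; rewrite /fn /= nth_rcons; case: gS => -> _ _ _; rewrite ltnn eqxx.
Qed.

(** Edges join vertices only, so a condition on the distance to a point of space, listed in [fixs],
    is anchored at a new fixed vertex. The induction moves the entries of [fixs] to [adj] one by
    one. *)
Lemma add_point (fixs : seq (V * R * bool)) D D' S (adj : seq (nat * R * bool)) g :
  good D S -> alls (fun e : V * R * bool => 0 < e.1.2) fixs ->
  uniq [seq e.1.1 | e <- adj] -> alls (fun e : nat * R * bool => (e.1.1 < sz S)%N /\ 0 < e.1.2) adj ->
  vnice g -> (forall u, D' u -> D u) ->
  (forall u W, D u ->
    (alls (fun e : V * R * bool => cmp e.2 (nq (W - e.1.1)) (e.1.2 ^+ 2)) fixs /\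
      alls (fun e : nat * R * bool => cmp e.2 (nq (W - fn S e.1.1 u)) (e.1.2 ^+ 2)) adj <->
     exists u', [/\ D' u', (forall i, (i < sz S)%N -> fn S i u' = fn S i u) & W = g u'])) ->
  exists S', new_vertex D' S g S'.
Proof.
elim: fixs S adj => [|[[z l] b] r IH] S adj gS /=.
  move=> _ ua la ng hD h.
  exists (St (rcons (vs S) (None, adj)) (rcons (fs S) g)); split.
  - by exists [:: (None, adj)], [:: g]; rewrite !cats1.
  - apply: (good_add (w := (None, adj)) gS ua la ng hD) => u W Du; rewrite -(h u W Du) /=.
    by split=> -[h1 h2].
  - exists (sz S); rewrite /sz /= size_rcons leqnn ltnSn; split=> // u.
    by rewrite /fn /= nth_rcons; case: gS => -> _ _ _; rewrite ltnn eqxx.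
  - move=> i u u' hi e; rewrite /fn /= nth_rcons; case: gS => -> _ _ _.
    by rewrite ltnNge hi /=; case: eqP.
move=> [l0 lr] ua la ng hD h.
have [S1 [e1 g1 s1 f1]] := add_fixed z gS.
have E i : (i < sz S)%N -> fn S1 i = fn S i by apply: ext_fn gS e1.
have [|||S' [e2 g2 [i [i1 i2 i3]] i4]] := IH S1 ((sz S, l, b) :: adj) g1 lr _ _ ng hD.
- rewrite /= ua andbT; apply/negP => /mapP [e he ee].
  by have := (proj1 (alls_mem _ _) la) e he; rewrite -ee ltnn => -[].
- rewrite /= s1 ltnSn; split=> //.
  by apply: alls_impl la => e [h1 h2]; split=> //; apply: ltnW.
- move=> u W Du /=; rewrite f1.
  rewrite (@eq_alls_in _ _ (fun e : nat * R * bool => cmp e.2 (nq (W - fn S e.1.1 u)) (e.1.2 ^+ 2)) _ _ _ la); last first.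
    by move=> e [he _]; rewrite E //; tauto.
  have -> : forall A B C : Prop, A /\ B /\ C <-> (B /\ A) /\ C by tauto.
  rewrite h //; split=> -[u' [D'u' h1 h2]]; exists u'; split=> // j hj.
    move: hj; rewrite s1 ltnS leq_eqVlt => /orP [/eqP ->|hj]; first by rewrite !f1.
    by rewrite !E // h1.
  by rewrite -!E // h1 // s1 ltnS ltnW.
exists S'; split=> //; first exact: ext_trans e2.
  by exists i; split=> //; apply: leq_trans i1; rewrite s1.
move=> k u u' hk e; move: hk; rewrite leq_eqVlt => /orP [/eqP <-|hk].
  by rewrite (ext_fn g1 e2) ?s1 // !f1.
by apply: i4; rewrite ?s1.
Qed.

Lemma add_point_det (fixs : seq (V * R * bool)) D S (adj : seq (nat * R * bool)) g :
  good D S -> alls (fun e : V * R * bool => 0 < e.1.2) fixs ->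
  uniq [seq e.1.1 | e <- adj] -> alls (fun e : nat * R * bool => (e.1.1 < sz S)%N /\ 0 < e.1.2) adj ->
  vnice g ->
  (forall u W, D u ->
    (alls (fun e : V * R * bool => cmp e.2 (nq (W - e.1.1)) (e.1.2 ^+ 2)) fixs /\
      alls (fun e : nat * R * bool => cmp e.2 (nq (W - fn S e.1.1 u)) (e.1.2 ^+ 2)) adj <-> W = g u)) ->
  exists S', new_vertex D S g S'.
Proof.
move=> gS h1 h2 h3 ng h; apply: (@add_point fixs D D S adj g) => // u W Du; rewrite h //.
split=> [->|[u' [D'u' e ->]]]; first by exists u.
(* The constraints see [u'] only through the old vertices, which agree with those of [u]; hence
   [g u] solves them at [u'] too. *)
apply/esym/(h _ _ D'u'); have [_ /(_ erefl) [k1 k2]] := h u (g u) Du.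
split=> //; move: k2; apply: (proj1 (eq_alls_in _ h3)) => x [hx _].
by rewrite e //; tauto.
Qed.

End Builder.

(** * Sums of rigid vectors *)

Section RigidVectors.
Variables (R : realType) (n : nat) (T : Type).
Notation V := 'rV[R]_n.

Record nice_class (D : T -> Prop) (nice : (T -> R) -> Prop) : Prop := NiceClass {
  nice_cst : forall k : R, nice (fun=> k);
  nice_add : forall f g, nice f -> nice g -> nice (fun u => f u + g u);
  nice_mul : forall f g, nice f -> nice g -> nice (fun u => f u * g u);
  nice_inv : forall f, nice f -> (forall u, D u -> f u != 0) -> nice (fun u => (f u)^-1);
  nice_sqrt : forall f, nice f -> (forall u, D u -> 0 < f u) -> nice (fun u => Num.sqrt (f u))
}.

Variables (D : T -> Prop) (nice : (T -> R) -> Prop).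
Hypothesis niceP : nice_class D nice.
Notation vnice := (vnice nice).
Notation good := (good nice D).
Implicit Types (S : st R n T) (f g a b X : T -> V).

Lemma nice_eq (f g : T -> R) : (forall u, f u = g u) -> nice g -> nice f.
Proof. by move=> h; rewrite (_ : f = g) //; apply/funext. Qed.

Lemma vnice_add f g : vnice f -> vnice g -> vnice (fun u => f u + g u).
Proof.
move=> hf hg j; apply: nice_eq (nice_add niceP (hf j) (hg j)) => u.
by rewrite mxE.
Qed.

Lemma vnice_mul (h : T -> R) f : nice h -> vnice f -> vnice (fun u => h u *: f u).
Proof.
by move=> hh hf j; apply: nice_eq (nice_mul niceP hh (hf j)) => u; rewrite mxE.
Qed.

Lemma vnice_scale (k : R) f : vnice f -> vnice (fun u => k *: f u).
Proof. by apply: vnice_mul; apply: nice_cst niceP _. Qed.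

Definition vat S i f := (i < sz S)%N /\ forall u, D u -> fn S i u = f u.
Definition vtxat S f := exists i, vat S i f.
Definition newat S f S' := [/\ ext S S', good S' &
  exists i, (sz S <= i)%N /\ vat S' i f].

Lemma vat_ext S S' i f : good S -> ext S S' -> vat S i f -> vat S' i f.
Proof.
move=> gS e [h1 h2]; split; first exact: leq_trans h1 (ext_sz e).
by move=> u Du; rewrite (ext_fn gS e h1) h2.
Qed.

Lemma vtxat_ext S S' f : good S -> ext S S' -> vtxat S f -> vtxat S' f.
Proof. by move=> gS e [i h]; exists i; apply: vat_ext h. Qed.

Lemma newat_vtx S S' f : newat S f S' -> vtxat S' f.
Proof. by move=> [_ _ [i [_ h]]]; exists i. Qed.

Lemma new_vertexW S S' f g : new_vertex nice D S g S' -> (forall u, D u -> g u = f u) ->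
  newat S f S'.
Proof.
move=> [e gS' [i [h1 h2 h3]] _] h; split=> //; exists i; split=> //; split=> // u Du.
by rewrite h3 h.
Qed.

Definition rigid f := exists2 c : R, 0 < c & forall u, D u -> nq (f u) = c ^+ 2.

Lemma add_zero S : good S -> exists S', newat S (fun=> 0) S'.
Proof.
move=> gS; have [S' [h1 h2 h3 h4]] := add_fixed (nice_cst niceP) 0 gS.
by exists S'; split=> //; exists (sz S); split=> //; split=> [|u _]; rewrite ?h3 ?h4.
Qed.

Lemma add_const S (z : V) : good S -> exists S', newat S (fun=> z) S'.
Proof.
move=> gS; have [S' [h1 h2 h3 h4]] := add_fixed (nice_cst niceP) z gS.
by exists S'; split=> //; exists (sz S); split=> //; split=> [|u _]; rewrite ?h3 ?h4.
Qed.

(** Bars of lengths [|k| c] to the origin and [|k - 1| c] to [a] form the degenerate triangle of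
    [collinear_unique]; the two excluded values of [k] would give a bar of length 0. *)
Lemma add_scale S a (k : R) : good S -> vtxat S a -> rigid a -> k != 0 -> k != 1 ->
  exists S', newat S (fun u => k *: a u) S'.
Proof.
move=> gS [i [hi ha]] [c c0 hc] k0 k1.
have [||||u W Du|S' hS'] := @add_point_det _ _ _ _ (nice_cst niceP)
  [:: (0, `|k| * c, false)] D S [:: (i, `|k - 1| * c, false)] (fun u => k *: fn S i u) gS.
- by split=> //=; rewrite mulr_gt0 // normr_gt0.
- by [].
- by split=> //=; split=> //; rewrite mulr_gt0 // normr_gt0 subr_eq0.
- by apply: vnice_scale => j; case: gS => _ _ h _; apply: h.
- rewrite /= subr0 !exprMn !real_normK ?num_real // ha //.
  split=> [[[h1 _] [h2 _]]|->]; first exact: (collinear_unique (hc u Du)).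
  rewrite -[X in _ - X]scale1r -scalerBl /nq !dotE -/(nq (a u)) hc // !expr2 !mulrA.
  by split; split.
exists S'; apply: new_vertexW hS' _ => u Du.
by rewrite ha.
Qed.

Lemma rigid_scale a (k : R) : k != 0 -> rigid a -> rigid (fun u => k *: a u).
Proof.
move=> k0 [c c0 hc]; exists (`|k| * c); first by rewrite mulr_gt0 // normr_gt0.
by move=> u Du; rewrite /nq !dotE -/(nq _) hc // exprMn real_normK ?num_real // mulrA.
Qed.

Lemma newat_trans S S1 S2 f g : newat S f S1 -> newat S1 g S2 -> newat S g S2.
Proof.
move=> [e1 g1 _] [e2 g2 [i [h1 h2]]]; split=> //; first exact: ext_trans e2.
by exists i; split=> //; apply: leq_trans h1; apply: ext_sz.
Qed.

(** A factor 1 would need a bar of length 0, so [a] is doubled and then halved. The copy has a fresh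
    index, as [add_translate] needs for the two neighbours of a parallelogram's corner to be
    distinct vertices. *)
Lemma add_copy S a : good S -> vtxat S a -> rigid a -> exists S', newat S a S'.
Proof.
move=> gS ha ra; have n20 : (2 : R) != 0 by rewrite pnatr_eq0.
have [||S1 h1] := add_scale gS ha ra (k := 2); rewrite ?pnatr_eq0 ?(eqr_nat _ 2 1) //.
have [_ gS1 _] := h1.
have [||S2 h2] := add_scale gS1 (newat_vtx h1) (rigid_scale n20 ra) (k := 2^-1).
- by rewrite invr_eq0.
- by rewrite invr_eq1 (eqr_nat _ 2 1).
exists S2; have [e2 g2 [i [i1 [i2 i3]]]] := newat_trans h1 h2.
split=> //; exists i; split=> //; split=> // u Du.
by rewrite i3 // scalerA mulVf // scale1r.
Qed.

(* W is the fourth corner and M the midpoint of the side opposite to v.  With d = W - v - w,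
   the function |w + t d|^2 takes the same value at t = 0, 1/2 and 1, which forces d = 0. *)
Lemma parallelogram_unique (c d : R) (v w W M : V) :
  nq v = c ^+ 2 -> nq w = d ^+ 2 -> nq (W - v) = d ^+ 2 -> nq (W - w) = c ^+ 2 ->
  nq (M - 2^-1 *: v) = d ^+ 2 -> nq (M - W) = (c / 2) ^+ 2 -> nq (M - w) = (c / 2) ^+ 2 ->
  W = v + w /\ M = w + 2^-1 *: v.
Proof.
move=> hv hw h1 h2 h3 h4 h5.
have hM : M - w = 2^-1 *: (W - w).
  apply: (collinear_unique h2); first by rewrite h5 exprMn mulrC.
  by rewrite opprB addrA subrK h4; field.
have {}hM : M = w + 2^-1 *: (W - w) by rewrite -hM addrC subrK.
have [e eE] : exists e, e = W - w - v by eexists.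
have e0 : e = 0.
  apply: nq_eq0; move: h3 h1.
  have -> : M - 2^-1 *: v = w + 2^-1 *: e by rewrite hM -addrA -scalerBr eE.
  have -> : W - v = w + e by rewrite eE; apply/rowP => j; rewrite !mxE; ring.
  rewrite -hw /nq !dotE (dotC e w); lra.
have {}e0 : W = v + w by apply/eqP; rewrite -subr_eq0 opprD addrA addrAC -eE e0.
by split=> //; rewrite hM e0 addrK.
Qed.

Lemma add_parallelogram S x y z X Y Z (u0 : T) : D u0 -> good S -> vat S x X -> vat S y Y -> vat S z Z ->
  y <> z -> rigid (fun u => Y u - X u) -> rigid (fun u => Z u - X u) ->
  exists S', newat S (fun u => Y u + Z u - X u) S'.
Proof.
move=> Du0 gS [hx ex] [hy ey] [hz ez] yz [c c0 hc] [d d0 hd].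
have c20 : 0 < c / 2 by rewrite divr_gt0.
have xy : x <> y.
  move=> xy; move: (hc u0 Du0); rewrite -ex // -ey // xy subrr /nq dot0l => /eqP.
  by rewrite eq_sym sqrf_eq0 gt_eqF.
have nS i : (i < sz S)%N -> vnice (fn S i) by case: gS => _ _ h _; apply: h.
(* The brace starts at the midpoint of [x] and [y], which is itself pinned by a degenerate
   triangle. *)
have [||||u W Du|S1 hS1] := @add_point_det _ _ _ _ (nice_cst niceP) [::] D S
    [:: (x, c / 2, false); (y, c / 2, false)] (fun u => 2^-1 *: (fn S x u + fn S y u)) gS.
- by [].
- by rewrite /= andbT inE; apply/eqP.
- by [].
- by apply: vnice_scale; apply: vnice_add; apply: nS.
- rewrite /= ex // ey //; have hcu := hc u Du.
  split=> [[_ [h1 [h2 _]]]|->].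
    have := @collinear_unique _ _ 2^-1 _ _ (W - X u) hcu.
    rewrite opprB addrA subrK h1 h2 => H.
    have {}H : W - X u = 2^-1 *: (Y u - X u) by apply: H; field.
    by apply/rowP => j; move/rowP/(_ j): H; rewrite !mxE; lra.
  have E1 : 2^-1 *: (X u + Y u) - X u = 2^-1 *: (Y u - X u).
    by apply/rowP => j; rewrite !mxE; field.
  have E2 : 2^-1 *: (X u + Y u) - Y u = (- 2^-1) *: (Y u - X u).
    by apply/rowP => j; rewrite !mxE; field.
  by rewrite E1 E2 /nq !(dotZl, dotZr) -/(nq _) hcu; split=> //; split; [|split]; rewrite //; field.
have [e1 gS1 [m [m1 m2 m3]] _] := hS1.
have E i : (i < sz S)%N -> fn S1 i = fn S i by apply: ext_fn gS e1.
have l1 i : (i < sz S)%N -> (i < sz S1)%N by move=> h; apply: leq_trans h (ext_sz e1).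
pose gW u := fn S y u + fn S z u - fn S x u.
pose gM u := 2^-1 *: (fn S y u - fn S x u) + fn S z u.
have nN f : vnice f -> vnice (fun u => - f u).
  move=> h j; apply: nice_eq (vnice_scale (-1) h j) => u.
  by rewrite scaleN1r.
(* The fourth corner alone could fold over and is not a function of [u] until the brace is present,
   so both vertices are added as one block. *)
pose ws : seq (vtx R n) := [:: (None, [:: (y, d, false); (z, c, false)]);
   (None, [:: (m, d, false); (sz S1, c / 2, false); (z, c / 2, false)])].
exists (St (vs S1 ++ ws) (fs S1 ++ [:: gW; gM])).
split.
- by apply: ext_trans e1 _; exists ws, [:: gW; gM].
- apply: (good_cat gS1) => //.
  + split=> /=.
    * by rewrite inE andbT; apply/eqP.
    * by rewrite !l1.
    split=> //=.
      rewrite !inE !negb_or !andbT; apply/andP; split; first (apply/andP; split).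
      - by rewrite ltn_eqF.
      - by rewrite gtn_eqF // (leq_trans hz).
      - by rewrite gtn_eqF // l1.
    by rewrite !ltnS (ltnW m2) leqnn (ltnW (l1 _ hz)).
  + case=> [|[|//]] _ /=.
      by apply: vnice_add; [apply: vnice_add; apply: nS|apply: nN; apply: nS].
    apply: vnice_add; last exact: nS.
    by apply: vnice_scale; apply: vnice_add; [apply: nS|apply: nN; apply: nS].
  move=> phi u Du hphi.
  rewrite /= /vtx_ok /= (hphi y (l1 _ hy)) (hphi z (l1 _ hz)) (hphi m m2) m3 !E //.
  have hcu := hc u Du; have hdu := hd u Du.
  split.
    move=> [[_ [h1 [h2 _]]] [[_ [h3 [h4 [h5 _]]]] _]].
    exists u; split=> //.
    move: h1 h2 h3 h4 h5; rewrite /gW /gM ex // ey // ez //.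
    set W := phi (sz S1); set M := phi (sz S1).+1 => h1 h2 h3 h4 h5.
    have [|||||] := @parallelogram_unique c d (Y u - X u) (Z u - X u) (W - X u) (M - X u) hcu hdu.
    * by rewrite opprB addrA subrK.
    * by rewrite opprB addrA subrK.
    * rewrite -h3; congr nq; apply/rowP => j; by rewrite !mxE; field.
    * by rewrite opprB addrA subrK.
    * by rewrite opprB addrA subrK.
    move=> /rowP hW /rowP hM; case=> [|[|//]] _ /=; rewrite ex // ey // ez //.
      by rewrite addn0 -/W; apply/rowP => j; move: (hW j); rewrite !mxE; lra.
    by rewrite addn1 -/M; apply/rowP => j; move: (hM j); rewrite !mxE; lra.
  move=> [u' [Du' e e']].
  have := e' 0%N isT; have := e' 1%N isT; rewrite /= addn0 addn1 /gW /gM.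
  have ee i : (i < sz S)%N -> fn S i u' = fn S i u by move=> hi; rewrite -E // e // l1.
  rewrite !ee // ex // ey // ez // => -> ->.
  have q1 : Y u + Z u - X u - Y u = Z u - X u by apply/rowP => j; rewrite !mxE; ring.
  have q2 : Y u + Z u - X u - Z u = Y u - X u by apply/rowP => j; rewrite !mxE; ring.
  have q3 : 2^-1 *: (Y u - X u) + Z u - 2^-1 *: (X u + Y u) = Z u - X u.
    by apply/rowP => j; rewrite !mxE; field.
  have q4 : 2^-1 *: (Y u - X u) + Z u - (Y u + Z u - X u) = (- 2^-1) *: (Y u - X u).
    by apply/rowP => j; rewrite !mxE; field.
  have q5 : 2^-1 *: (Y u - X u) + Z u - Z u = 2^-1 *: (Y u - X u).
    by apply/rowP => j; rewrite !mxE; field.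
  rewrite q1 q2 q3 q4 q5 hcu hdu /nq !(dotZl, dotZr) -/(nq _) hcu.
  by do !split=> //; field.
exists (sz S1); split; first exact: ext_sz.
split; first by rewrite /sz /= size_cat /= addn2 ltnS leqnSn.
move=> u Du; rewrite /fn /= nth_cat; case: gS1 => -> _ _ _.
by rewrite ltnn subnn /= /gW ex // ey // ez.
Qed.

End RigidVectors.

(** * Vectors carried by sums of arms *)

Section Constructible.
Variables (R : realType) (n : nat) (T : Type) (D : T -> Prop) (nice : (T -> R) -> Prop).
Hypothesis niceP : nice_class D nice.
Variable u0 : T.
Hypothesis Du0 : D u0.
Notation V := 'rV[R]_n.
Notation good := (good nice D).
Notation vat := (vat D).
Notation vtxat := (vtxat D).
Notation newat := (newat D nice).
Notation rigid := (rigid D).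
Implicit Types (S : st R n T) (f g a b X F G : T -> V).

Lemma vtxat_eq S f g : (forall u, D u -> f u = g u) -> vtxat S f -> vtxat S g.
Proof. by move=> h [i [h1 h2]]; exists i; split=> // u Du; rewrite h2 // h. Qed.

Lemma newat_eq S S' f g : (forall u, D u -> f u = g u) -> newat S f S' -> newat S g S'.
Proof.
move=> h [e gS' [i [h1 [h2 h3]]]]; split=> //; exists i; split=> //; split=> // u Du.
by rewrite h3 // h.
Qed.

Lemma rigid_eq f g : (forall u, D u -> f u = g u) -> rigid f -> rigid g.
Proof. by move=> h [c c0 hc]; exists c => // u Du; rewrite -h // hc. Qed.

(** A vertex tied to the origin by steps of constant length; each step can be the side of a
    parallelogram that carries another vector along. *)
Inductive reach S : (T -> V) -> Prop :=
| Reach0 X : vtxat S X -> (forall u, D u -> X u = 0) -> reach S X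
| ReachS X Y : reach S X -> vtxat S Y -> rigid (fun u => Y u - X u) -> reach S Y.

Lemma reach_vtx S X : reach S X -> vtxat S X.
Proof. by case. Qed.

Lemma reach_ext S S' X : good S -> ext S S' -> reach S X -> reach S' X.
Proof.
move=> gS e; elim=> [Y hY Y0|Y Z _ IH hZ r]; first exact: Reach0 (vtxat_ext gS e hY) Y0.
exact: ReachS IH (vtxat_ext gS e hZ) r.
Qed.

(* The translate of a along a chain of rigid bars, one parallelogram per bar. *)
Lemma add_translate S X a : good S -> reach S X -> vtxat S a -> rigid a ->
  exists S', newat S (fun u => X u + a u) S'.
Proof.
move=> gS rX ha ra; elim: rX => [{}X _ X0|{}X Y rX [S1 [e1 g1 [i [i1 i2]]]] [y hy] rY].
  have [S' h] := add_copy niceP gS ha ra; exists S'.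
  by apply: newat_eq h => u Du; rewrite X0 // add0r.
have [x hx] := reach_vtx rX.
have [|||S2 h2] := @add_parallelogram _ _ _ _ _ niceP S1 x y i _ _ _ _ Du0 g1
  (vat_ext gS e1 hx) (vat_ext gS e1 hy) i2.
- by move=> yi; case: hy => hy _; move: hy; rewrite yi ltnNge i1.
- exact: rY.
- by apply: rigid_eq ra => u Du; rewrite addrAC subrr add0r.
exists S2; have h1 : newat S (fun u => X u + a u) S1 by split=> //; exists i.
apply: newat_eq (newat_trans h1 h2) => u Du.
by rewrite (addrC (X u)) addrA addrK.
Qed.

(** [F] may vary in length, but its arms, all based at the origin, do not. A vertex at [F] itself is
    only produced by [rep_vertex]. *)
Inductive rep S : (T -> V) -> Prop :=
| Rep0 F : (forall u, D u -> F u = 0) -> rep S F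
| RepS a F G : vtxat S a -> rigid a -> rep S F -> (forall u, D u -> G u = a u + F u) -> rep S G.

Lemma rep_ext S S' F : good S -> ext S S' -> rep S F -> rep S' F.
Proof.
move=> gS e; elim=> [G G0|a G H ha ra _ IH E]; first exact: Rep0.
exact: RepS (vtxat_ext gS e ha) ra IH E.
Qed.

Lemma rep_eq S F G : (forall u, D u -> F u = G u) -> rep S F -> rep S G.
Proof.
move=> h rF; case: rF h => [H h0|a H K ha ra rH E] h; first by apply: Rep0 => u Du; rewrite -h // h0.
by apply: (RepS ha ra rH) => u Du; rewrite -h // E.
Qed.

Lemma rep_add S F G : rep S F -> rep S G -> rep S (fun u => F u + G u).
Proof.
move=> rF rG; elim: rF => [H h0|a H K ha ra _ IH E].
  by apply: rep_eq rG => u Du; rewrite h0 // add0r.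
by apply: (RepS ha ra IH) => u Du; rewrite E // addrA.
Qed.

Lemma rep_scale S F (k : R) : good S -> rep S F ->
  exists S', [/\ ext S S', good S' & rep S' (fun u => k *: F u)].
Proof.
move=> gS rF; have [->|k0] := eqVneq k 0.
  by exists S; split=> //; [exact: ext_refl|apply: Rep0 => u Du; rewrite scale0r].
have [->|k1] := eqVneq k 1.
  by exists S; split=> //; [exact: ext_refl|apply: rep_eq rF => u Du; rewrite scale1r].
elim: rF => [H h0|a H K ha ra _ [S1 [e1 g1 r1]] E].
  by exists S; split=> //; [exact: ext_refl|apply: Rep0 => u Du; rewrite h0 // scaler0].
have [S2 h2] := add_scale niceP g1 (vtxat_ext gS e1 ha) ra k0 k1.
have [e2 g2 _] := h2.
exists S2; split=> //; first exact: ext_trans e2.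
apply: (RepS (newat_vtx h2) (rigid_scale k0 ra) (rep_ext g1 e2 r1)) => u Du.
by rewrite E // scalerDr.
Qed.

(** Consecutive partial sums of the arms differ by one rigid arm, so they form a chain as in
    [reach], along which the next arm is translated. *)
Lemma rep_vertex S F : good S -> rep S F ->
  exists S', [/\ ext S S', good S' & reach S' F].
Proof.
move=> gS rF; elim: rF => [H h0|a H K ha ra _ [S1 [e1 g1 r1]] E].
  have [S1 h1] := add_zero (n := n) niceP gS; have [e1 g1 _] := h1.
  exists S1; split=> //; apply: (Reach0 _ h0).
  by apply: vtxat_eq (newat_vtx h1) => u Du; rewrite h0.
have ha1 := vtxat_ext gS e1 ha.
have [S2 h2] := add_translate g1 r1 ha1 ra; have [e2 g2 _] := h2.
exists S2; split=> //; first exact: ext_trans e2.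
apply: (ReachS (reach_ext g1 e2 r1)).
  by apply: vtxat_eq (newat_vtx h2) => u Du; rewrite E // addrC.
by apply: rigid_eq ra => u Du; rewrite E // addrK.
Qed.

Variable S0 : st R n T.

(* Quantifying over all extensions of S0 lets constructions be performed one after the other. *)
Definition con F := forall S, good S -> ext S0 S ->
  exists S', [/\ ext S S', good S' & rep S' F].

Lemma con_eq F G : (forall u, D u -> F u = G u) -> con F -> con G.
Proof.
move=> h cF S gS e; have [S' [e' g' r']] := cF S gS e.
by exists S'; split=> //; apply: rep_eq r'.
Qed.

Lemma con_add F G : con F -> con G -> con (fun u => F u + G u).
Proof.
move=> cF cG S gS e; have [S1 [e1 g1 r1]] := cF S gS e.
have [S2 [e2 g2 r2]] := cG S1 g1 (ext_trans e e1).
exists S2; split=> //; first exact: ext_trans e2.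
by apply: rep_add => //; apply: rep_ext r1.
Qed.

Lemma con_scale F (k : R) : con F -> con (fun u => k *: F u).
Proof.
move=> cF S gS e; have [S1 [e1 g1 r1]] := cF S gS e.
have [S2 [e2 g2 r2]] := rep_scale k g1 r1.
by exists S2; split=> //; exact: ext_trans e2.
Qed.

Lemma con_sub F G : con F -> con G -> con (fun u => F u - G u).
Proof.
move=> cF cG; apply: con_eq (con_add cF (con_scale (-1) cG)) => u Du.
by rewrite scaleN1r.
Qed.

Lemma con_vertex F S : con F -> good S -> ext S0 S ->
  exists S', [/\ ext S S', good S' & vtxat S' F].
Proof.
move=> cF gS e; have [S1 [e1 g1 r1]] := cF S gS e.
have [S2 [e2 g2 r2]] := rep_vertex g1 r1.
by exists S2; split=> //; [exact: ext_trans e2|apply: reach_vtx].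
Qed.

Lemma con_rigid a : rigid a ->
  (forall S, good S -> ext S0 S -> exists S', [/\ ext S S', good S' & vtxat S' a]) -> con a.
Proof.
move=> ra h S gS e; have [S' [e' g' h']] := h S gS e.
exists S'; split=> //; apply: (RepS h' ra (Rep0 S' (F := fun=> 0) _)) => // u Du.
by rewrite addr0.
Qed.

Lemma con_const (z : V) : con (fun=> z).
Proof.
have [->|z0] := eqVneq z 0.
  by move=> S gS e; exists S; split=> //; [exact: ext_refl|exact: Rep0].
apply: con_rigid => [|S gS e].
  exists (Num.sqrt (nq z)) => [|u Du]; last by rewrite sqr_sqrtr // nq_ge0.
  rewrite sqrtr_gt0 lt_neqAle nq_ge0 andbT eq_sym.
  by apply: contra_neq z0 => /nq_eq0.
have [S' h] := add_const niceP z gS; have [e' g' _] := h.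
by exists S'; split=> //; apply: newat_vtx h.
Qed.

End Constructible.

(** * Plane gadgets *)

Section PlaneGeometry.
Variables (R : realType) (n : nat) (i j : 'I_n).
Hypothesis ij : i != j.
Notation V := 'rV[R]_n.
Implicit Types (W z P : V) (p q a b : R).

Definition ek (k : 'I_n) : V := delta_mx ord0 k.

Lemma ekE k l : ek k ord0 l = (l == k)%:R.
Proof. by rewrite mxE eqxx. Qed.

Lemma dot_ek W k : dot W (ek k) = W ord0 k.
Proof.
rewrite /dot (bigD1 k) //= ekE eqxx mulr1 big1 ?addr0 // => l /negbTE lk.
by rewrite ekE lk mulr0.
Qed.

Lemma nq_ek k : nq (ek k) = 1.
Proof. by rewrite /nq dot_ek ekE eqxx. Qed.

Definition pl a b : V := a *: ek i + b *: ek j.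

Lemma pl_i a b : pl a b ord0 i = a.
Proof. by rewrite !mxE !eqxx /= (negbTE ij) mulr1 mulr0 addr0. Qed.

Lemma pl_j a b : pl a b ord0 j = b.
Proof. by rewrite !mxE !eqxx /= eq_sym (negbTE ij) mulr1 mulr0 add0r. Qed.

Lemma pl_k a b k : k != i -> k != j -> pl a b ord0 k = 0.
Proof. by move=> /negbTE ki /negbTE kj; rewrite !mxE ki kj !andbF !mulr0 addr0. Qed.

Lemma nq_pl a b : nq (pl a b) = a ^+ 2 + b ^+ 2.
Proof. by rewrite /nq {1}/pl dotDl !dotZl !(dotC (ek _)) !dot_ek pl_i pl_j -!expr2. Qed.

Lemma plB a b a' b' : pl a b - pl a' b' = pl (a - a') (b - b').
Proof. by apply/rowP => k; rewrite !mxE; ring. Qed.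

Lemma plD a b a' b' : pl a b + pl a' b' = pl (a + a') (b + b').
Proof. by apply/rowP => k; rewrite !mxE; ring. Qed.

Lemma plZ (c : R) a b : c *: pl a b = pl (c * a) (c * b).
Proof. by apply/rowP => k; rewrite !mxE; ring. Qed.

Definition planar W := W = pl (W ord0 i) (W ord0 j).

Lemma planarP W : planar W <-> forall k, k != i -> k != j -> W ord0 k = 0.
Proof.
split=> [-> k|h]; first exact: pl_k.
apply/rowP => k; have [->|ki] := eqVneq k i; first by rewrite pl_i.
by have [->|kj] := eqVneq k j; [rewrite pl_j|rewrite pl_k // h].
Qed.

Lemma planar_pl a b : planar (pl a b).
Proof. by apply/planarP => k; apply: pl_k. Qed.

Definition plane_fix z (r : R) : seq (V * R * bool) :=
  [seq (z + ek k, Num.sqrt (r ^+ 2 + 1), false) | k <- enum 'I_n & (k != i) && (k != j)].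

Lemma sqrt_r1 (r : R) : Num.sqrt (r ^+ 2 + 1) ^+ 2 = r ^+ 2 + 1.
Proof. by rewrite sqr_sqrtr // addr_ge0 // sqr_ge0. Qed.

Lemma sqrt_r1_gt0 (r : R) : 0 < Num.sqrt (r ^+ 2 + 1).
Proof. by rewrite sqrtr_gt0 ltr_wpDl // sqr_ge0. Qed.

Lemma plane_fix_gt0 z r : alls (fun e : V * R * bool => 0 < e.1.2) (plane_fix z r).
Proof. by apply/alls_mem => e /mapP [k _ ->]; apply: sqrt_r1_gt0. Qed.

Lemma plane_fixP z r W : planar z -> nq (W - z) = r ^+ 2 ->
  (alls (fun e : V * R * bool => cmp e.2 (nq (W - e.1.1)) (e.1.2 ^+ 2)) (plane_fix z r) <-> planar W).
Proof.
move=> /planarP hz hr; rewrite planarP.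
have E k : k != i -> k != j -> nq (W - (z + ek k)) = r ^+ 2 + 1 - 2 * W ord0 k.
  move=> ki kj; rewrite opprD addrA {1}/nq !(dotDl _ (- ek k)) !(dotDr _ (- ek k)) -/(nq (W - z)).
  by rewrite !(dotNl, dotNr) (dotC (ek k) (W - z)) -/(nq (ek k)) nq_ek dot_ek hr !mxE hz //; ring.
rewrite alls_mem; split=> [h k ki kj|h e /mapP [k]].
  have : (z + ek k, Num.sqrt (r ^+ 2 + 1), false) \in plane_fix z r.
    by apply: map_f; rewrite mem_filter ki kj mem_enum.
  by move=> /h /=; rewrite E // sqrt_r1; lra.
rewrite mem_filter => /andP [/andP [ki kj] _] -> /=.
by rewrite E // h // sqrt_r1; ring.
Qed.

(* On |W| = r, a distance sqrt (r^2 + 1) to a unit vector e means W _|_ e, and a cable of that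
   length means <W, e> >= 0: so these constraints cut out a half circle in the (i, j)-plane. *)
Definition half_fix (s r : R) (c : 'I_n) : seq (V * R * bool) :=
  [:: (0, r, false), (s *: ek c, Num.sqrt (r ^+ 2 + 1), true) & plane_fix 0 r].

Lemma half_fix_gt0 s r c : 0 < r -> alls (fun e : V * R * bool => 0 < e.1.2) (half_fix s r c).
Proof. by move=> r0; split=> //=; split; [apply: sqrt_r1_gt0|apply: plane_fix_gt0]. Qed.

Lemma half_fixP s r c W : s ^+ 2 = 1 ->
  (alls (fun e : V * R * bool => cmp e.2 (nq (W - e.1.1)) (e.1.2 ^+ 2)) (half_fix s r c) <->
   [/\ planar W, nq W = r ^+ 2 & 0 <= s * W ord0 c]).
Proof.
move=> s1; rewrite /= subr0 sqrt_r1.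
have E : nq W = r ^+ 2 -> (nq (W - s *: ek c) <= r ^+ 2 + 1 <-> 0 <= s * W ord0 c).
  move=> hr; have -> : nq (W - s *: ek c) = r ^+ 2 + 1 - 2 * (s * W ord0 c).
    rewrite /nq !dotE (dotC (ek c) W) -/(nq W) -/(nq (ek c)) nq_ek dot_ek hr.
    by move: s1; rewrite expr2; lra.
  by split=> h; lra.
have p0 : planar 0 by apply/planarP => k _ _; rewrite mxE.
split=> [[h1 [h2 h3]]|[h1 h2 h3]].
  split=> //; last exact/E.
  by apply/(plane_fixP p0 _); last exact: h3; rewrite subr0.
split=> //; split; first exact/E.
by apply/(plane_fixP p0 _) => //; rewrite subr0.
Qed.

Section Elbow.
Variables (s L l : R).
Hypotheses (s1 : s ^+ 2 = 1) (l0 : 0 < l) (lL : l <= L).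

(** From [|W| = L] and [|W - P| = l] one gets [<W, P> = (r2 + L^2 - l^2) / 2 = h r2], so that
    [W = h P + s k JP] or [W = h P - s k JP], with [J] the quarter turn. *)
Definition elbow_h (r2 : R) := (1 + (L ^+ 2 - l ^+ 2) / r2) / 2.
Definition elbow_k (r2 : R) := Num.sqrt (L ^+ 2 / r2 - elbow_h r2 ^+ 2).

Definition elbow P : V :=
  let p := P ord0 i in let q := P ord0 j in let r2 := p ^+ 2 + q ^+ 2 in
  pl (elbow_h r2 * p - s * elbow_k r2 * q) (elbow_h r2 * q + s * elbow_k r2 * p).

(** The second condition is [|P - L e_i| < l]. The point [- L e_i] lies outside the circle of radius
    [l] about [P], as [0 < P_i] and [l <= L]; so each half circle from [L e_i] to [- L e_i] crosses
    that circle exactly once. *)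
Definition elbow_dom P :=
  0 < P ord0 i /\ P ord0 i ^+ 2 + P ord0 j ^+ 2 + L ^+ 2 - l ^+ 2 < 2 * L * P ord0 i.

Lemma elbow_facts p q : 0 < p -> p ^+ 2 + q ^+ 2 + L ^+ 2 - l ^+ 2 < 2 * L * p ->
  let r2 := p ^+ 2 + q ^+ 2 in let m := elbow_h r2 * r2 in let k := elbow_k r2 in
  [/\ 0 < r2, m = (r2 + L ^+ 2 - l ^+ 2) / 2, 0 < m < L * p, 0 < L ^+ 2 / r2 - elbow_h r2 ^+ 2 &
     0 < k /\ (k * r2) ^+ 2 = L ^+ 2 * r2 - m ^+ 2].
Proof.
move=> p0 hpq r2 m k.
have L0 : 0 < L by apply: lt_le_trans lL.
have q20 : 0 <= q ^+ 2 by apply: sqr_ge0.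
have r20 : 0 < r2 by rewrite ltr_wpDr ?exprn_gt0.
have mE : m = (r2 + L ^+ 2 - l ^+ 2) / 2.
  by rewrite /m /elbow_h; field; rewrite gt_eqF.
have Ll : l ^+ 2 <= L ^+ 2 by rewrite lerXn2r ?nnegrE // ltW.
have m0 : 0 < m by rewrite mE divr_gt0 // -addrA ltr_wpDr // subr_ge0.
have mL : m < L * p by rewrite mE ltr_pdivrMr // /r2; lra.
have hE : elbow_h r2 = m / r2 by rewrite /m mulfK // gt_eqF.
have pos : 0 < L ^+ 2 * r2 - m ^+ 2.
  rewrite subr_gt0; apply: (@lt_le_trans _ _ ((L * p) ^+ 2)).
    by rewrite ltrXn2r // ltW.
  by rewrite exprMn ler_wpM2l ?sqr_ge0 // /r2 lerDl.
have posk : 0 < L ^+ 2 / r2 - elbow_h r2 ^+ 2.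
  have -> : L ^+ 2 / r2 - elbow_h r2 ^+ 2 = (L ^+ 2 * r2 - m ^+ 2) / r2 ^+ 2.
    by rewrite hE; field; rewrite gt_eqF.
  by rewrite divr_gt0 // exprn_gt0.
split=> //; first by rewrite m0.
split; first by rewrite /k /elbow_k sqrtr_gt0.
rewrite exprMn /k /elbow_k sqr_sqrtr; last exact: ltW.
by rewrite hE; field; rewrite gt_eqF.
Qed.

Lemma elbowP P W : planar P -> elbow_dom P ->
  ([/\ planar W, nq W = L ^+ 2, 0 <= s * W ord0 j & nq (W - P) = l ^+ 2] <-> W = elbow P).
Proof.
move=> pP [p0 hpq]; rewrite /elbow; move: pP p0 hpq; rewrite /planar.
set p := P ord0 i; set q := P ord0 j => pP p0 hpq /=.
have [] := elbow_facts p0 hpq; set r2 := p ^+ 2 + q ^+ 2; set h := elbow_h r2; set k := elbow_k r2.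
move=> r20 mE /andP [m0 mL] _ [k0 kE].
have r2n : r2 != 0 by rewrite gt_eqF.
(* Up to a factor [r2^2] this is [(h q)^2 < (k p)^2]: in [s W_j = s h q + k p] or [s h q - k p] the
   last term decides the sign, so the cable selects the branch. *)
have dom_ineq : (h * r2) ^+ 2 * q ^+ 2 < (L ^+ 2 * r2 - (h * r2) ^+ 2) * p ^+ 2.
  have h4 : (h * r2) ^+ 2 < (L * p) ^+ 2 by rewrite ltrXn2r // ltW.
  have h5 : 0 < ((L * p) ^+ 2 - (h * r2) ^+ 2) * r2 by rewrite mulr_gt0 // subr_gt0.
  rewrite -subr_gt0; move: h5; congr (_ < _); move: (h * r2) => m'.
  by rewrite /r2; ring.
split.
  rewrite /planar pP; set a := W ord0 i; set b := W ord0 j => -[-> ].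
  rewrite plB !nq_pl => hL sb hl.
  have hm : a * p + b * q = h * r2 by rewrite mE /r2; move: hL hl; rewrite !expr2; lra.
  (* [t] is the inner product of [W] with the quarter turn of [P]; its square is known and only its
     sign is in question. *)
  pose t := b * p - a * q.
  have ht : t ^+ 2 = (k * r2) ^+ 2.
    by rewrite kE -hm -hL /t /r2; ring.
  have aE : a * r2 = h * r2 * p - t * q by rewrite -hm /t /r2; ring.
  have bE : b * r2 = h * r2 * q + t * p by rewrite -hm /t /r2; ring.
  have st : (s * t == k * r2) || (s * t == - (k * r2)).
    by rewrite -eqf_sqr exprMn s1 mul1r ht.
  have tE : t = s * (k * r2).
    have tst : t = s * (s * t) by rewrite mulrA -expr2 s1 mul1r.
    case/orP: st => /eqP st; first by rewrite tst st.
    exfalso.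
    have h1 : 0 <= s * b * r2 by rewrite mulr_ge0 // ltW.
    have h2 : k * r2 * p <= s * (h * r2) * q.
      have h1' : s * b * r2 = s * (h * r2) * q + (s * t) * p by rewrite -mulrA bE; ring.
      by move: h1; rewrite h1' st; lra.
    have h3 : (k * r2 * p) ^+ 2 <= (s * (h * r2) * q) ^+ 2.
      by rewrite lerXn2r ?nnegrE // ?(le_trans _ h2) // ?mulr_ge0 // ltW.
    have e1 : (k * r2 * p) ^+ 2 = (k * r2) ^+ 2 * p ^+ 2 by ring.
    have e2 : (s * (h * r2) * q) ^+ 2 = s ^+ 2 * ((h * r2) ^+ 2 * q ^+ 2) by ring.
    have h5 := dom_ineq; move: h3; rewrite e1 e2 kE s1 mul1r leNgt => /negP; apply.
    exact: h5.
  congr pl.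
    by apply: (mulIf r2n); rewrite aE tE; ring.
  by apply: (mulIf r2n); rewrite bE tE; ring.
move=> ->; split; first exact: planar_pl.
- rewrite nq_pl; apply: (mulIf (expf_neq0 2 r2n)).
  have -> : L ^+ 2 * r2 ^+ 2 = ((h * r2) ^+ 2 + s ^+ 2 * (k * r2) ^+ 2) * r2.
    by rewrite s1 kE; ring.
  by rewrite /r2; ring.
- rewrite pl_j mulrDr.
  have -> : s * (s * k * p) = k * p by rewrite !mulrA -expr2 s1 mul1r.
  rewrite -(pmulr_lge0 _ r20).
  have h6 : (h * r2 * q) ^+ 2 <= (k * r2 * p) ^+ 2.
    have -> : (k * r2 * p) ^+ 2 = (k * r2) ^+ 2 * p ^+ 2 by ring.
    by rewrite exprMn kE ltW.
  have h7 : `|h * r2 * q| <= k * r2 * p.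
    have kp0 : 0 <= k * r2 * p by rewrite !mulr_ge0 // ltW.
    by rewrite -ler_sqr ?nnegrE // real_normK ?num_real.
  have h8 : `|s| = 1 by rewrite -sqrtr_sqr s1 sqrtr1.
  have h9 : `|s * (h * r2 * q)| <= k * r2 * p by rewrite normrM h8 mul1r.
  by move: h9; rewrite ler_norml => /andP [h9 _]; move: h9; lra.
rewrite pP plB nq_pl; apply: (mulIf (expf_neq0 2 r2n)).
have -> : l ^+ 2 = r2 + L ^+ 2 - 2 * (h * r2) by rewrite mE; field.
have -> : (r2 + L ^+ 2 - 2 * (h * r2)) * r2 ^+ 2 =
    ((h * r2) ^+ 2 + s ^+ 2 * (k * r2) ^+ 2 + r2 ^+ 2 - 2 * (h * r2) * r2) * r2.
  by rewrite s1 kE; ring.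
by rewrite /r2; ring.
Qed.

Lemma elbow_nq P : planar P -> elbow_dom P -> nq (elbow P) = L ^+ 2.
Proof. by move=> pP dP; have [_ /(_ erefl) []] := elbowP (elbow P) pP dP. Qed.

End Elbow.

(** At squared distance [2 L^2], [W] is orthogonal to [(a0, a1)], hence one of its two quarter
    turns. Their [i]-coordinates are [- a1] and [a1], nonzero of known sign, so a half circle
    separates them. *)
Lemma half_turn_unique s L a0 a1 W : s ^+ 2 = 1 -> 0 < L -> a0 ^+ 2 + a1 ^+ 2 = L ^+ 2 ->
  0 < s * a1 ->
  ([/\ planar W, nq W = L ^+ 2, 0 <= - s * W ord0 i &
     nq (W - pl a0 a1) = 2 * L ^+ 2] <-> W = pl (- a1) a0).
Proof.
move=> s1 L0 hA sa; have L20 : L ^+ 2 != 0 by rewrite expf_neq0 // gt_eqF.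
split.
  rewrite /planar; set a := W ord0 i; set b := W ord0 j => -[->].
  rewrite plB !nq_pl => hW sa' hd.
  have h0 : a * a0 + b * a1 = 0 by move: hd hW hA; rewrite !expr2; lra.
  pose t := b * a0 - a * a1.
  have ht : t ^+ 2 = (L ^+ 2) ^+ 2.
    have -> : t ^+ 2 = (a ^+ 2 + b ^+ 2) * (a0 ^+ 2 + a1 ^+ 2) - (a * a0 + b * a1) ^+ 2.
      by rewrite /t; ring.
    by rewrite h0 hW hA expr0n /= subr0 -expr2.
  have aE : a * L ^+ 2 = - t * a1.
    have -> : - t * a1 = a * (a0 ^+ 2 + a1 ^+ 2) - (a * a0 + b * a1) * a0 by rewrite /t; ring.
    by rewrite h0 mul0r subr0 hA.
  have bE : b * L ^+ 2 = t * a0.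
    have -> : t * a0 = b * (a0 ^+ 2 + a1 ^+ 2) - (a * a0 + b * a1) * a1 by rewrite /t; ring.
    by rewrite h0 mul0r subr0 hA.
  have tE : t = L ^+ 2.
    move/eqP: ht; rewrite eqf_sqr => /orP [/eqP //|/eqP tL]; exfalso.
    have h1 : a = a1 by apply: (mulIf L20); rewrite aE tL; ring.
    by move: sa' sa; rewrite h1; lra.
  by congr pl; apply: (mulIf L20); rewrite ?aE ?bE tE; ring.
move=> ->; split; first exact: planar_pl.
- by rewrite nq_pl sqrrN addrC.
- by rewrite pl_i mulrNN ltW.
- by rewrite plB nq_pl -hA; ring.
Qed.

End PlaneGeometry.

Section Gadgets.
Variables (R : realType) (n : nat) (T : Type) (D : T -> Prop) (nice : (T -> R) -> Prop).
Hypothesis niceP : nice_class D nice.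
Variable u0 : T.
Hypothesis Du0 : D u0.
Variable S0 : st R n T.
Notation V := 'rV[R]_n.
Notation good := (good nice D).
Notation vtxat := (vtxat D).
Notation newat := (newat D nice).
Notation con := (con D nice S0).

Section Frame.
Variables (i j : 'I_n).
Hypothesis ij : i != j.
Implicit Types (S : st R n T) (P A : T -> V) (f : T -> R).

Notation pl := (pl i j).

Lemma vnice_pl (a b : T -> R) : nice a -> nice b -> vnice nice (fun u => pl (a u) (b u)).
Proof.
by move=> na nb; apply: (vnice_add niceP); apply: (vnice_mul niceP) => // k; apply: nice_cst niceP _.
Qed.

Lemma nice_sub (f g : T -> R) : nice f -> nice g -> nice (fun u => f u - g u).
Proof.
move=> nf ng.
apply: nice_eq (nice_add niceP nf (nice_mul niceP (nice_cst niceP (-1)) ng)) => u.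
by rewrite mulN1r.
Qed.

Lemma nice_sqr (f : T -> R) : nice f -> nice (fun u => f u ^+ 2).
Proof. by move=> nf; apply: nice_eq (nice_mul niceP nf nf) => u; rewrite expr2. Qed.

Lemma vnice_elbow (s L l : R) P : 0 < l -> l <= L -> vnice nice P ->
  (forall u, D u -> elbow_dom i j L l (P u)) -> vnice nice (fun u => elbow i j s L l (P u)).
Proof.
move=> l0 lL nP dP; rewrite /elbow /=.
pose r2 u := P u ord0 i ^+ 2 + P u ord0 j ^+ 2.
have nr : nice r2 by apply: (nice_add niceP); apply: nice_sqr; apply: nP.
have fact u : D u -> 0 < r2 u /\ 0 < L ^+ 2 / r2 u - elbow_h L l (r2 u) ^+ 2.
  by move=> Du; have [p0 hp] := dP u Du; have [h1 _ _ h2 _] := elbow_facts l0 lL p0 hp.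
have nri : nice (fun u => (r2 u)^-1).
  by apply: (nice_inv niceP) => // u Du; have [h _] := fact u Du; rewrite gt_eqF.
have nh : nice (fun u => elbow_h L l (r2 u)).
  apply: (nice_mul niceP _ (nice_cst niceP _)); apply: (nice_add niceP (nice_cst niceP _)).
  exact: (nice_mul niceP (nice_cst niceP _)).
have nk : nice (fun u => elbow_k L l (r2 u)).
  apply: (nice_sqrt niceP) => [|u Du]; last by have [] := fact u Du.
  by apply: nice_sub (nice_sqr nh); apply: (nice_mul niceP (nice_cst niceP _)).
have nsk : nice (fun u => s * elbow_k L l (r2 u)) by apply: (nice_mul niceP (nice_cst niceP _)).
apply: vnice_pl; [apply: nice_sub|apply: (nice_add niceP)].
- exact: (nice_mul niceP nh (nP i)).
- exact: (nice_mul niceP nsk (nP j)).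
- exact: (nice_mul niceP nh (nP j)).
- exact: (nice_mul niceP nsk (nP i)).
Qed.

Lemma add_elbow S (s L l : R) P : s ^+ 2 = 1 -> 0 < l -> l <= L -> good S -> vtxat S P ->
  (forall u, D u -> planar i j (P u)) -> (forall u, D u -> elbow_dom i j L l (P u)) ->
  exists S', newat S (fun u => elbow i j s L l (P u)) S'.
Proof.
move=> s1 l0 lL gS [x [hx ex]] pP dP.
have L0 : 0 < L by apply: lt_le_trans lL.
have [||||u W Du|S' hS'] := @add_point_det _ _ _ _ (nice_cst niceP) (half_fix i j s L j)
  D S [:: (x, l, false)] (fun u => elbow i j s L l (fn S x u)) gS.
- exact: half_fix_gt0.
- by [].
- by split.
- by apply: vnice_elbow => // [|u Du]; [case: gS => _ _ h _; apply: h|rewrite ex //; apply: dP].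
- have pu := pP u Du; have du := dP u Du.
  rewrite half_fixP //= ex // -(elbowP ij s1 l0 lL W pu du); split.
    by move=> [[h1 h2 h3] [h4 _]].
  by move=> [h1 h2 h3 h4]; split; split.
by exists S'; apply: new_vertexW hS' _ => u Du; rewrite ex.
Qed.

Lemma con_elbow (s L l : R) P : s ^+ 2 = 1 -> 0 < l -> l <= L -> con P ->
  (forall u, D u -> planar i j (P u)) -> (forall u, D u -> elbow_dom i j L l (P u)) ->
  con (fun u => elbow i j s L l (P u)).
Proof.
move=> s1 l0 lL cP pP dP; apply: con_rigid => [|S gS e].
  exists L; first by apply: lt_le_trans lL.
  by move=> u Du; apply: elbow_nq => //; [exact: pP|exact: dP].
have [S1 [e1 g1 v1]] := con_vertex niceP Du0 cP gS e.
have [S2 h2] := add_elbow s1 l0 lL g1 v1 pP dP; have [e2 g2 _] := h2.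
by exists S2; split=> //; [exact: ext_trans e2|exact: newat_vtx h2].
Qed.

Lemma add_half_turn S (s L : R) A : s ^+ 2 = 1 -> 0 < L -> good S -> vtxat S A ->
  (forall u, D u -> [/\ planar i j (A u), nq (A u) = L ^+ 2 & 0 < s * A u ord0 j]) ->
  exists S', newat S (fun u => pl (- A u ord0 j) (A u ord0 i)) S'.
Proof.
move=> s1 L0 gS [x [hx ex]] hA.
have s21 : (- s) ^+ 2 = 1 by rewrite sqrrN.
have sq2 : Num.sqrt 2 ^+ 2 = 2 :> R by rewrite sqr_sqrtr.
have [||||u W Du|S' hS'] := @add_point_det _ _ _ _ (nice_cst niceP) (half_fix i j (- s) L i)
  D S [:: (x, Num.sqrt 2 * L, false)] (fun u => pl (- fn S x u ord0 j) (fn S x u ord0 i)) gS.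
- exact: half_fix_gt0.
- by [].
- by split=> //; split=> //=; rewrite mulr_gt0 // sqrtr_gt0.
- have nx : vnice nice (fn S x) by case: gS => _ _ h _; apply: h.
  apply: vnice_pl => //; apply: nice_eq (nice_mul niceP (nice_cst niceP (-1)) (nx j)) => u.
  by rewrite mulN1r.
- have [pA nA sA] := hA u Du.
  have h0 : A u ord0 i ^+ 2 + A u ord0 j ^+ 2 = L ^+ 2 by rewrite -nA {3}pA nq_pl.
  rewrite half_fixP //= ex // -(half_turn_unique ij W s1 L0 h0 sA) -pA exprMn sq2; split.
    by move=> [[h1 h2 h3] [h4 _]].
  by move=> [h1 h2 h3 h4]; split; split.
by exists S'; apply: new_vertexW hS' _ => u Du; rewrite ex.
Qed.

Lemma con_half_turn (s L : R) A : s ^+ 2 = 1 -> 0 < L -> con A ->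
  (forall u, D u -> [/\ planar i j (A u), nq (A u) = L ^+ 2 & 0 < s * A u ord0 j]) ->
  con (fun u => pl (- A u ord0 j) (A u ord0 i)).
Proof.
move=> s1 L0 cA hA; apply: con_rigid => [|S gS e].
  exists L => // u Du; have [pA nA _] := hA u Du.
  by rewrite nq_pl // sqrrN addrC -(nq_pl ij) -pA.
have [S1 [e1 g1 v1]] := con_vertex niceP Du0 cA gS e.
have [S2 h2] := add_half_turn s1 L0 g1 v1 hA; have [e2 g2 _] := h2.
by exists S2; split=> //; [exact: ext_trans e2|exact: newat_vtx h2].
Qed.

(** The two elbows are mirror images in the line of [W], so their sum keeps only the radial part. *)
Lemma elbow_add (L l : R) W :
  elbow i j 1 L l W + elbow i j (-1) L l W =
  pl (2 * elbow_h L l (W ord0 i ^+ 2 + W ord0 j ^+ 2) * W ord0 i)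
     (2 * elbow_h L l (W ord0 i ^+ 2 + W ord0 j ^+ 2) * W ord0 j).
Proof. rewrite /elbow plD; apply: f_equal2; ring. Qed.

(* The cell with arms 5/3 and bars 4/3 (so that L^2 - l^2 = 1) inverts in the unit circle. *)
Lemma con_inversion P : con P -> (forall u, D u -> planar i j (P u)) ->
  (forall u, D u -> 3 / 4 <= P u ord0 i <= 5 / 4 /\ `|P u ord0 j| <= 1 / 4) ->
  con (fun u => (P u ord0 i ^+ 2 + P u ord0 j ^+ 2)^-1 *: P u).
Proof.
move=> cP pP hP; pose L : R := 5 / 3; pose l : R := 4 / 3.
have l0 : 0 < l by rewrite /l; lra.
have lL : l <= L by rewrite /l /L; lra.
have q2 u : D u -> P u ord0 j ^+ 2 <= 1 / 16.
  move=> Du; have [_ h] := hP u Du.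
  have -> : 1 / 16 = (1 / 4) ^+ 2 :> R by field.
  by rewrite -real_normK ?num_real // lerXn2r // nnegrE; lra.
have dP u : D u -> elbow_dom i j L l (P u).
  move=> Du; have [/andP [h1 h2] _] := hP u Du; have h3 := q2 u Du.
  (* The chord bound for the square of the first coordinate, which makes the domain inequality
     linear. *)
  have h4 : 0 <= (P u ord0 i - 3 / 4) * (5 / 4 - P u ord0 i) by rewrite mulr_ge0 //; lra.
  split; first lra.
  move: h3 h4; rewrite /L /l !expr2; lra.
have s11 : (1 : R) ^+ 2 = 1 by rewrite expr1n.
have s12 : (-1 : R) ^+ 2 = 1 by rewrite sqrrN expr1n.
have c1 := con_elbow s11 l0 lL cP pP dP.
have c2 := con_elbow s12 l0 lL cP pP dP.
apply: con_eq (con_sub niceP (con_add c1 c2) cP) => u Du /=.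
rewrite elbow_add [X in _ - X](pP u Du) [X in _ = _ *: X](pP u Du) plB plZ.
have [_ _ _ _ _] := elbow_facts l0 lL (dP u Du).1 (dP u Du).2.
have r0 : 0 < P u ord0 i ^+ 2 + P u ord0 j ^+ 2.
  by have [] := elbow_facts l0 lL (dP u Du).1 (dP u Du).2.
have -> : 2 * elbow_h L l (P u ord0 i ^+ 2 + P u ord0 j ^+ 2) =
    1 + (P u ord0 i ^+ 2 + P u ord0 j ^+ 2)^-1.
  by rewrite /elbow_h /L /l; field; rewrite gt_eqF.
by apply: f_equal2; ring.
Qed.

Lemma con_line_inv f : con (fun u => f u *: ek R i) ->
  (forall u, D u -> 3 / 4 <= f u <= 5 / 4) -> con (fun u => (f u)^-1 *: ek R i).
Proof.
move=> cf hf.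
have E u : f u *: ek R i = pl (f u) 0 by rewrite /pl scale0r addr0.
apply: con_eq (con_inversion cf _ _) => u Du; last 2 first.
- by rewrite E; apply: planar_pl.
- by rewrite E pl_i // pl_j // normr0 hf //; split=> //; lra.
have f0 : f u != 0 by have /andP [h _] := hf u Du; rewrite gt_eqF //; lra.
by rewrite E pl_i // pl_j // -E scalerA expr0n /= addr0; congr (_ *: _); field.
Qed.

(** [con_half_turn] asks for constant length, which [f e_i] lacks. The elbows with [L = l = 1] write
    it as the diagonal of a rhombus with unit sides; the sides are turned separately and the parts
    along [e_i] cancel. *)
Lemma con_line_turn f : con (fun u => f u *: ek R i) ->
  (forall u, D u -> 3 / 4 <= f u <= 5 / 4) -> con (fun u => f u *: ek R j).
Proof.
move=> cf hf.
have E u : f u *: ek R i = pl (f u) 0 by rewrite /pl scale0r addr0.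
have pP u : D u -> planar i j (f u *: ek R i) by rewrite E => _; apply: planar_pl.
have dP u : D u -> elbow_dom i j 1 1 (f u *: ek R i).
  move=> Du; have /andP [h1 h2] := hf u Du; rewrite E /elbow_dom pl_i // pl_j //; split; first lra.
  have : 0 < f u * (2 - f u) by rewrite mulr_gt0 //; lra.
  by rewrite !expr2; lra.
have h12 (r : R) : elbow_h 1 1 r = 2^-1 by rewrite /elbow_h subrr mul0r addr0 mul1r.
have half s : s ^+ 2 = 1 ->
    con (fun u => pl (- (s * elbow_k 1 1 (f u ^+ 2) * f u)) (f u / 2)).
  move=> s1; have cE := con_elbow s1 ltr01 (lexx 1) cf pP dP.
  have eE u : elbow i j s 1 1 (f u *: ek R i) = pl (f u / 2) (s * elbow_k 1 1 (f u ^+ 2) * f u).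
    rewrite /elbow E pl_i // pl_j // expr0n /= addr0 h12; congr pl; ring.
  apply: con_eq (con_half_turn s1 ltr01 cE _) => u Du; first by rewrite eE pl_i // pl_j.
  split; first by rewrite eE; apply: planar_pl.
    by apply: elbow_nq => //; [apply: pP|apply: dP].
  have [f0 df] := dP u Du; have [_ _ _ _ [k0 _]] := elbow_facts ltr01 (lexx 1) f0 df.
  rewrite eE pl_j // !mulrA -expr2 s1 mul1r mulr_gt0 //.
    by move: k0; rewrite E pl_i // pl_j // expr0n /= addr0.
  by have /andP [h _] := hf u Du; lra.
have s11 : (1 : R) ^+ 2 = 1 by rewrite expr1n.
have s12 : (-1 : R) ^+ 2 = 1 by rewrite sqrrN expr1n.
apply: con_eq (con_add (half _ s11) (half _ s12)) => u Du.
rewrite plD -[RHS]add0r -(scale0r (ek R i)) -/(pl 0 (f u)).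
by apply: f_equal2; [ring|field].
Qed.

(** Inversion sends [(1, t) / (1 + t^2)] to [(1, t)], and removing [e_i] leaves [t e_j]; for
    [|t| <= 1/4] the point is in the range of [con_inversion]. *)
Lemma con_line_variable (t : T -> R) :
  con (fun u => (1 + t u ^+ 2)^-1 *: pl 1 (t u)) -> (forall u, D u -> `|t u| <= 1 / 4) ->
  con (fun u => t u *: ek R j).
Proof.
move=> ct ht.
have tp u : 0 < 1 + t u ^+ 2 by rewrite ltr_wpDr // sqr_ge0.
have t2 u : D u -> t u ^+ 2 <= 1 / 16.
  move=> Du; have -> : 1 / 16 = (1 / 4) ^+ 2 :> R by field.
  by rewrite -real_normK ?num_real // lerXn2r ?nnegrE ?ht //; lra.
have ki : con (fun=> ek R i) by apply: con_const.
apply: con_eq (con_sub niceP (con_inversion ct _ _) ki) => u Du; last 2 first.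
- by rewrite plZ; apply: planar_pl.
- rewrite plZ pl_i // pl_j //.
  have ht2 := t2 u Du; have t20 : 0 <= t u ^+ 2 by apply: sqr_ge0.
  rewrite mulr1; split.
    apply/andP; split.
      by rewrite -[X in X <= _]invrK lef_pV2 ?posrE ?invr_gt0 //; lra.
    by rewrite -[X in _ <= X]invrK lef_pV2 ?posrE ?invr_gt0 //; lra.
  rewrite normrM gtr0_norm ?invr_gt0 //; apply: le_trans (ht u Du).
  by rewrite ler_piMl // invf_le1 // lerDl.
rewrite plZ pl_i // pl_j //.
have -> : ek R i = pl 1 0 by rewrite /pl scale1r scale0r addr0.
rewrite plZ plB -[t u *: _]add0r -(scale0r (ek R i)) -/(pl 0 (t u)).
have tn : 1 + t u ^+ 2 != 0 by rewrite gt_eqF.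
by apply: f_equal2; field.
Qed.

End Frame.

(** * Arithmetic of bounded scalar functions *)

Section Scalars.
Variables (i j : 'I_n).
Hypothesis ij : i != j.
Implicit Types (f g : T -> R).

Definition scal f := con (fun u => f u *: ek R i) /\ exists M : R, forall u, D u -> `|f u| <= M.

Lemma scal_eq f g : (forall u, D u -> f u = g u) -> scal f -> scal g.
Proof.
move=> h [cf [M hM]]; split; first by apply: con_eq cf => u Du; rewrite h.
by exists M => u Du; rewrite -h // hM.
Qed.

Lemma scal_add f g : scal f -> scal g -> scal (fun u => f u + g u).
Proof.
move=> [cf [M hM]] [cg [N hN]]; split.
  by apply: con_eq (con_add cf cg) => u Du; rewrite scalerDl.
by exists (M + N) => u Du; apply: le_trans (ler_normD _ _) (lerD (hM u Du) (hN u Du)).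
Qed.

Lemma scal_scale (k : R) f : scal f -> scal (fun u => k * f u).
Proof.
move=> [cf [M hM]]; split.
  by apply: con_eq (con_scale niceP k cf) => u Du; rewrite scalerA.
by exists (`|k| * M) => u Du; rewrite normrM ler_wpM2l // hM.
Qed.

Lemma scal_const (k : R) : scal (fun=> k).
Proof. by split; [exact: con_const|exists `|k|]. Qed.

(** With this [e], the values [1 + e f] and [1 - e f] lie in [3/4, 5/4], where [con_line_inv] and
    [con_line_turn] work. *)
Lemma scal_near1 f : (exists M : R, forall u, D u -> `|f u| <= M) ->
  exists2 e : R, 0 < e & forall u, D u -> `|e * f u| <= 1 / 4.
Proof.
move=> [M hM]; have M0 : 0 < 4 * (`|M| + 1) by rewrite mulr_gt0 // ltr_wpDl.
exists (4 * (`|M| + 1))^-1 => [|u Du]; first by rewrite invr_gt0.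
rewrite normrM gtr0_norm ?invr_gt0 // mulrC ler_pdivrMr //.
have := hM u Du; have := ler_norm M; lra.
Qed.

Lemma scal_sqr f : scal f -> scal (fun u => f u ^+ 2).
Proof.
move=> sf; have [e e0 he] := scal_near1 sf.2.
have fe u : D u -> - (1 / 4) <= e * f u <= 1 / 4 by move=> Du; rewrite -ler_norml he.
have inv (s : R) : s = 1 \/ s = -1 -> con (fun u => (1 + s * e * f u)^-1 *: ek R i).
  move=> hs; apply: (con_line_inv ij).
    exact: (scal_add (scal_const 1) (scal_scale (s * e) sf)).1.
  by move=> u Du; have := fe u Du; case: hs => ->; rewrite ?mul1r ?mulN1r ?mulNr; lra.
have sqe u : D u -> 0 <= (e * f u) ^+ 2 <= 1 / 16.
  move=> Du; rewrite sqr_ge0 /=; have -> : 1 / 16 = (1 / 4) ^+ 2 :> R by field.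
  by rewrite -real_normK ?num_real // lerXn2r ?nnegrE ?he //; lra.
have c1 : con (fun u => (1 - (e * f u) ^+ 2)^-1 *: ek R i).
  apply: con_eq (con_scale niceP 2^-1 (con_add (inv 1 (or_introl erefl)) (inv (-1) (or_intror erefl)))) => u Du.
  rewrite -scalerDl scalerA; congr (_ *: _).
  have := fe u Du; rewrite (mul1r e) (mulN1r e) (mulNr e); move: (e * f u) => a /andP [a1 a2].
  have -> : 1 - a ^+ 2 = (1 - a) * (1 + a) by ring.
  field; apply/andP; split; rewrite gt_eqF //; lra.
(* Since [1 / (1 - x^2)] lies between 1 and 16/15 for [|x| <= 1/4], a second inversion is in range
   and returns [1 - x^2]. *)
have c2 : con (fun u => (1 - (e * f u) ^+ 2) *: ek R i).
  have hb u : D u -> 3 / 4 <= (1 - (e * f u) ^+ 2)^-1 <= 5 / 4.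
    move=> Du; have := sqe u Du; set x := (e * f u) ^+ 2 => hx.
    have x0 : 0 < 1 - x by lra.
    apply/andP; split.
      by rewrite -[X in X <= _]invrK lef_pV2 ?posrE ?invr_gt0 //; lra.
    by rewrite -[X in _ <= X]invrK lef_pV2 ?posrE ?invr_gt0 //; lra.
  have c3 := con_line_inv (f := fun u => (1 - (e * f u) ^+ 2)^-1) ij c1 hb.
  by apply: con_eq c3 => u Du; rewrite invrK.
split.
  have ki : con (fun=> ek R i) by apply: con_const.
  have c3 := con_scale niceP (e ^- 2) (con_sub niceP ki c2).
  apply: con_eq c3 => u Du.
  rewrite -[X in X - _]scale1r -scalerBl scalerA; congr (_ *: _).
  by field; rewrite gt_eqF.
have [M hM] := sf.2; exists (M ^+ 2) => u Du.
by rewrite normrX lerXn2r ?nnegrE // ?hM // (le_trans _ (hM u Du)).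
Qed.

Lemma scal_mul f g : scal f -> scal g -> scal (fun u => f u * g u).
Proof.
move=> sf sg.
have := scal_scale 4^-1 (scal_add (scal_sqr (scal_add sf sg))
   (scal_scale (-1) (scal_sqr (scal_add sf (scal_scale (-1) sg))))).
by apply: scal_eq => u Du; field.
Qed.

Lemma scal_exp f m : scal f -> scal (fun u => f u ^+ m).
Proof.
move=> sf; elim: m => [|m IH]; first by apply: scal_eq (scal_const 1) => u _; rewrite expr0.
by apply: scal_eq (scal_mul sf IH) => u _; rewrite exprS.
Qed.

Lemma scal_sum (J : Type) (r : seq J) (F : J -> T -> R) :
  (forall k, scal (F k)) -> scal (fun u => \sum_(k <- r) F k u).
Proof.
move=> h; elim: r => [|k r IH].
  by apply: scal_eq (scal_const 0) => u _; rewrite big_nil.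
by apply: scal_eq (scal_add (h k) IH) => u _; rewrite big_cons.
Qed.

Lemma scal_prod (J : Type) (r : seq J) (F : J -> T -> R) :
  (forall k, scal (F k)) -> scal (fun u => \prod_(k <- r) F k u).
Proof.
move=> h; elim: r => [|k r IH].
  by apply: scal_eq (scal_const 1) => u _; rewrite big_nil.
by apply: scal_eq (scal_mul (h k) IH) => u _; rewrite big_cons.
Qed.

End Scalars.

Lemma scal_turn (i j : 'I_n) (f : T -> R) : i != j -> scal i f -> con (fun u => f u *: ek R j).
Proof.
move=> ij sf; have [e e0 he] := scal_near1 sf.2.
have c1 : con (fun u => (1 + e * f u) *: ek R j).
  apply: (con_line_turn ij); first exact: (scal_add (scal_const i 1) (scal_scale e sf)).1.
  by move=> u Du; have := he u Du; rewrite ler_norml; lra.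
have kj : con (fun=> ek R j) by apply: con_const.
apply: con_eq (con_scale niceP e^-1 (con_sub niceP c1 kj)) => u Du.
rewrite -[X in _ - X]scale1r -scalerBl scalerA; congr (_ *: _).
by field; rewrite gt_eqF.
Qed.

Lemma scal_con (i j : 'I_n) (f : T -> R) : scal i f -> con (fun u => f u *: ek R j).
Proof. by have [-> []|ij] := eqVneq i j; [|apply: scal_turn]. Qed.

Lemma con_vector (i : 'I_n) (F : T -> V) : (forall k, scal i (fun u => F u ord0 k)) -> con F.
Proof.
move=> h; have H (r : seq 'I_n) : con (fun u => \sum_(k <- r) F u ord0 k *: ek R k).
  elim: r => [|k r IH]; first by apply: con_eq (_ : con (fun=> 0)) => [u _|]; [rewrite big_nil|apply: con_const].
  by apply: con_eq (con_add (scal_con k (h k)) IH) => u _; rewrite big_cons.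
apply: con_eq (H (index_enum _)) => u _; apply/rowP => l.
rewrite summxE (bigD1 l) //= mxE ekE eqxx mulr1 big1 ?addr0 // => k kl.
by rewrite mxE ekE eq_sym (negbTE kl) mulr0.
Qed.

End Gadgets.

(** * Free variables and constraints *)

Section Assembly.
Variables (R : realType) (n N : nat) (nice : ('rV[R]_N -> R) -> Prop).
Hypothesis nice_const : forall k : R, nice (fun=> k).
Notation V := 'rV[R]_n.
Notation T := 'rV[R]_N.
Notation state := (st R n T).

Lemma good_iff (D D' : T -> Prop) (S : state) : (forall u, D u <-> D' u) -> good nice D S -> good nice D' S.
Proof.
move=> h [h1 h2 h3 h4]; split=> // phi; rewrite h4.
by split=> -[u [Du hu]]; exists u; split=> //; apply/h.
Qed.

Definition cut_ok (S : state) (u : T) (c : nat * V * R * bool) :=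
  cmp c.2 (nq (fn S c.1.1.1 u - c.1.1.2)) (c.1.2 ^+ 2).

(* A bound on the distance from a vertex to a point z: attach it to a new vertex fixed at z. *)
Lemma add_cuts (cs : seq (nat * V * R * bool)) (D : T -> Prop) (S : state) : good nice D S ->
  alls (fun c : nat * V * R * bool => (c.1.1.1 < sz S)%N /\ 0 < c.1.2) cs ->
  exists S', ext S S' /\ good nice (fun u => D u /\ alls (cut_ok S u) cs) S'.
Proof.
elim: cs D S => [|[[[x z] c] b] cs IH] D S gS.
  by move=> _; exists S; split; [exact: ext_refl|apply: good_iff gS => u /=; tauto].
move=> [[hx c0] hcs].
pose D' u := D u /\ cut_ok S u (x, z, c, b).
pose S1 : state := St (rcons (vs S) (Some z, [:: (x, c, b)])) (rcons (fs S) (fun=> z)).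
have e1 : ext S S1 by exists [:: (Some z, [:: (x, c, b)])], [:: fun=> z]; rewrite !cats1.
have nqC (v w : V) : nq (v - w) = nq (w - v) by rewrite -opprB /nq dotNl dotNr opprK.
have g1 : good nice D' S1.
  apply: (good_add (w := (Some z, [:: (x, c, b)])) gS); [by []|by []| | |].
  - by move=> l; apply: nice_const.
  - by move=> u [].
  move=> u W Du /=.
  split=> [[h1 [h2 _]]|[u' [[Du' h1] h2 ->]]].
    have WE : W = z by apply: h1.
    by exists u; split=> //; split=> //; rewrite /cut_ok /= nqC -WE.
  split; first by move=> z' [].
  by split=> //; move: h1; rewrite /cut_ok /= nqC h2.
have hcs1 : alls (fun c : nat * V * R * bool => (c.1.1.1 < sz S1)%N /\ 0 < c.1.2) cs.
  by apply: alls_impl hcs => e [h1 h2]; split=> //; apply: leq_trans h1 (ext_sz e1).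
have [S2 [e2 g2]] := IH D' S1 g1 hcs1.
exists S2; split; first exact: ext_trans e2.
apply: good_iff g2 => u.
have -> : alls (cut_ok S1 u) cs <-> alls (cut_ok S u) cs.
  by apply: (eq_alls_in _ hcs) => e [h _]; rewrite /cut_ok (ext_fn gS e1 h); tauto.
by rewrite /D' /=; tauto.
Qed.

Lemma con_vertices (D : T -> Prop) (u0 : T) (S0 S : state) (J : eqType) (r : seq J) (F : J -> T -> V) :
  nice_class D nice -> D u0 ->
  (forall k, con D nice S0 (F k)) -> good nice D S -> ext S0 S ->
  exists S', [/\ ext S S', good nice D S' & forall k, k \in r -> vtxat D S' (F k)].
Proof.
move=> niceP Du0 hF gS e; elim: r => [|k r [S1 [e1 g1 h1]]].
  by exists S; split=> //; exact: ext_refl.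
have [S2 [e2 g2 h2]] := con_vertex niceP Du0 (hF k) g1 (ext_trans e e1).
exists S2; split=> // [|k']; first exact: ext_trans e2.
by rewrite inE => /orP [/eqP ->//|/h1 h]; exact: vtxat_ext g1 e2 h.
Qed.

Section FreeVariables.
Variables (i j : 'I_n) (B : R).
Hypotheses (ij : i != j) (B0 : 0 < B).

(** The factor [4 B] turns [|y_k| <= B] into [|t| <= 1/4], the range of [con_line_variable]. *)
Definition tvar (k : 'I_N) (y : T) : R := y ord0 k / (4 * B).

(* The point of the circle |P - e_i/2| = 1/2 whose inverse is e_i + t e_j, seen from the centre. *)
Definition circle_pt (t : R) : V := (1 + t ^+ 2)^-1 *: pl i j 1 t - 2^-1 *: ek R i.

Definition box (m : nat) (y : T) := forall k : 'I_N, (k < m)%N -> `|y ord0 k| <= B.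

Lemma circle_ptE (t : R) :
  circle_pt t = pl i j ((1 + t ^+ 2)^-1 - 2^-1) (t / (1 + t ^+ 2)).
Proof.
have eE : 2^-1 *: ek R i = pl i j 2^-1 0 by rewrite /pl scale0r addr0.
by rewrite /circle_pt eE plZ plB; apply: f_equal2; ring.
Qed.

(** On this circle [|W - e_i / 2|^2 = t^2 / (1 + t^2)], and a bound 1/17 on it means
    [t^2 <= 1/16]. *)
Lemma circle_ptP (W : V) :
  [/\ planar i j W, nq W = 2^-1 ^+ 2 & nq (W - 2^-1 *: ek R i) <= 17^-1] <->
  exists2 t : R, `|t| <= 1 / 4 & W = circle_pt t.
Proof.
have eE : 2^-1 *: ek R i = pl i j 2^-1 0 by rewrite /pl scale0r addr0.
split.
  rewrite /planar eE; move: (W ord0 i) (W ord0 j) => a b [-> ].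
  rewrite plB !nq_pl // subr0 => h1 h2.
  (* The [i]-coordinate before the centre was moved to the origin: it equals [1 / (1 + t^2)], and
     the slope [b / a'] is [t]. *)
  pose a' := a + 2^-1.
  have h3 : a' ^+ 2 + b ^+ 2 = a' by move: h1; rewrite /a' !expr2; lra.
  have h4 : 16 / 17 <= a' by move: h1 h2; rewrite /a' !expr2; lra.
  have a0 : 0 < a' by lra.
  have an : a' != 0 by rewrite gt_eqF.
  have ht : 1 + (b / a') ^+ 2 = a'^-1.
    have -> : 1 + (b / a') ^+ 2 = (a' ^+ 2 + b ^+ 2) / a' ^+ 2 by field.
    by rewrite h3; field.
  exists (b / a').
    have h5 : (b / a') ^+ 2 <= (1 / 4) ^+ 2.
      have : 1 + (b / a') ^+ 2 <= 17 / 16.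
        by rewrite ht -[leRHS]invrK lef_pV2 ?posrE ?invr_gt0 //; lra.
      by move: ((b / a') ^+ 2) => x; rewrite expr2; lra.
    by rewrite -ler_sqr ?nnegrE // real_normK ?num_real.
  rewrite circle_ptE ht invrK; apply: f_equal2; first by rewrite /a' addrK.
  by field.
move=> [t ht ->]; rewrite circle_ptE eE.
have t0 : 0 < 1 + t ^+ 2 by rewrite ltr_wpDr // sqr_ge0.
have tn : 1 + t ^+ 2 != 0 by rewrite gt_eqF.
split; first exact: planar_pl.
  by rewrite nq_pl //; field.
rewrite plB nq_pl // subr0.
have -> : ((1 + t ^+ 2)^-1 - 2^-1 - 2^-1) ^+ 2 + (t / (1 + t ^+ 2)) ^+ 2 = 1 - (1 + t ^+ 2)^-1.
  by field.
have h5 : t ^+ 2 <= (1 / 4) ^+ 2 by rewrite -real_normK ?num_real // ler_sqr ?nnegrE //; lra.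
have h6 : 16 / 17 <= (1 + t ^+ 2)^-1.
  by rewrite -[leLHS]invrK lef_pV2 ?posrE ?invr_gt0 //; move: h5; rewrite (expr2 (1 / 4)); lra.
lra.
Qed.

Lemma circle_pt_nq (t : R) : nq (circle_pt t) = 2^-1 ^+ 2.
Proof.
rewrite circle_ptE.
by rewrite nq_pl //; field; rewrite gt_eqF // ltr_wpDr // sqr_ge0.
Qed.

Hypothesis nice_circle : forall k, vnice nice (fun y => circle_pt (tvar k y)).

Lemma variables_state m : (m <= N)%N -> exists S : state,
  [/\ good nice (box m) S,
    forall x (y y' : T), (x < sz S)%N -> (forall k : 'I_N, (k < m)%N -> y ord0 k = y' ord0 k) ->
      fn S x y = fn S x y' &
    forall k : 'I_N, (k < m)%N -> exists x, (x < sz S)%N /\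
      forall y, fn S x y = circle_pt (tvar k y)].
Proof.
elim: m => [_|m IH hm].
  exists (St [::] [::]); split=> //; split=> // phi /=; split=> // _.
  by exists 0; split.
have [S [gS dS hS]] := IH (ltnW hm).
pose k0 : 'I_N := Ordinal hm.
have dn : forall u, box m.+1 u -> box m u by move=> u h k hk; apply: h; apply: ltnW.
have r0 : 0 < Num.sqrt 17^-1 :> R by rewrite sqrtr_gt0 invr_gt0.
have r2 : Num.sqrt 17^-1 ^+ 2 = 17^-1 :> R by rewrite sqr_sqrtr // invr_ge0.
have h20 : 0 < 2^-1 :> R by rewrite invr_gt0.
have p0 : planar i j (0 : V) by apply/planarP => // k _ _; rewrite mxE.
have [||||||S' [e' g' [x [x1 x2 x3]] x4]] := @add_point _ _ _ _ nice_const
  [:: (0, 2^-1, false), (2^-1 *: ek R i, Num.sqrt 17^-1, true) & plane_fix i j 0 2^-1]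
  (box m) (box m.+1) S [::] (fun y => circle_pt (tvar k0 y)) gS.
- by split=> //=; split=> //; apply: plane_fix_gt0.
- by [].
- by [].
- exact: nice_circle.
- exact: dn.
- move=> u W Du; rewrite /= subr0 r2.
  have -> : (nq W = 2^-1 ^+ 2 /\ nq (W - 2^-1 *: ek R i) <= 17^-1 /\
    alls (fun e : V * R * bool => cmp e.2 (nq (W - e.1.1)) (e.1.2 ^+ 2)) (plane_fix i j 0 2^-1)) /\ True
    <-> [/\ planar i j W, nq W = 2^-1 ^+ 2 & nq (W - 2^-1 *: ek R i) <= 17^-1].
    split=> [[[h1 [h2 h3]] _]|[h1 h2 h3]].
      have h1' : nq (W - 0) = 2^-1 ^+ 2 by rewrite subr0.
      by split=> //; apply/(plane_fixP ij p0 h1').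
    have h2' : nq (W - 0) = 2^-1 ^+ 2 by rewrite subr0.
    by split=> //; split=> //; split=> //; apply/(plane_fixP ij p0 h2').
  rewrite circle_ptP; have Bn : 4 * B != 0 by rewrite mulf_neq0 // ?gt_eqF.
  split=> [[t ht ->]|[u' [Du' _ ->]]]; last first.
    exists (tvar k0 u') => //; rewrite /tvar normrM normrV ?unitfE // (gtr0_norm (x := 4 * B)) ?mulr_gt0 //.
    by rewrite ler_pdivrMr ?mulr_gt0 //; have := Du' k0 (ltnSn _); lra.
  (* Only coordinate [k0] is overwritten, by the value at which [tvar] equals [t]. *)
  exists (\row_k (if k == k0 then t * (4 * B) else u ord0 k)); split.
  - move=> k; rewrite ltnS leq_eqVlt => hk; rewrite mxE; case: eqP => kk.
      by rewrite normrM (gtr0_norm (x := 4 * B)) ?mulr_gt0 // mulrCA mulrA; move: ht B0; nra.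
    case/orP: hk => [/eqP hk|hk]; last exact: Du.
    by case: kk; apply/val_inj.
  - move=> x hx; apply: dS => // k hk; rewrite mxE ifF //; apply/negbTE.
    by apply: contraTneq hk => ->; rewrite ltnn.
  - by rewrite /tvar mxE eqxx mulfK.
exists S'; split=> //.
  move=> z y y' hz hy.
  have [hz'|hz'] := ltnP z (sz S); last first.
    by apply: x4 => //; rewrite /tvar (hy k0).
  by rewrite (ext_fn gS e' hz'); apply: dS => // k hk; apply: hy; apply: ltnW.
move=> k; rewrite ltnS leq_eqVlt => /orP [/eqP hk|hk].
  have -> : k = k0 by apply/val_inj.
  by exists x.
have [z [hz ez]] := hS k hk; exists z; split; first exact: leq_trans hz (ext_sz e').
by move=> y; rewrite (ext_fn gS e' hz).
Qed.

End FreeVariables.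

End Assembly.

(** * The linkage of a list of vertices *)

Section LinkageOf.
Variables (R : realType) (n : nat) (ws : seq (vtx R n)).
Hypothesis wf : wff 0 ws.
Notation V := 'rV[R]_n.

Definition node i : vtx R n := nth (None, [::]) ws i.

Lemma wff_nth M (ts : seq (vtx R n)) i : wff M ts -> (i < size ts)%N ->
  uniq [seq e.1.1 | e <- (nth (None, [::]) ts i).2] /\
  forall e, e \in (nth (None, [::]) ts i).2 -> (e.1.1 < M + i)%N /\ 0 < e.1.2.
Proof.
elim: ts M i => // w ts IH M [|i] /= [h1 h2 h3] hi.
  by split=> // e he; rewrite addn0; apply: (proj1 (alls_mem _ _) h2).
by have := IH M.+1 i h3 hi; rewrite addSnnS.
Qed.

Lemma satf_nth M (ts : seq (vtx R n)) phi : satf M ts phi <->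
  forall i, (i < size ts)%N -> vtx_ok phi (M + i) (nth (None, [::]) ts i).
Proof.
elim: ts M => [|w ts IH] M /=; first by split.
rewrite IH; split=> [[h1 h2] [|i] hi|h].
- by rewrite addn0.
- by rewrite -addSnnS; apply: h2.
split; first by have := h 0%N; rewrite addn0; apply.
by move=> i hi; rewrite addSnnS; apply: (h i.+1).
Qed.

Lemma node_edge i e : (i < size ws)%N -> e \in (node i).2 -> (e.1.1 < i)%N /\ 0 < e.1.2.
Proof. by move=> hi; apply: (wff_nth wf hi).2. Qed.

Lemma node_uniq i e e' : (i < size ws)%N -> e \in (node i).2 -> e' \in (node i).2 ->
  e.1.1 = e'.1.1 -> e = e'.
Proof.
move=> hi; have [u _] := wff_nth wf hi; rewrite -/(node i) in u.
elim: (node i).2 u => // x s IH /= /andP [xs us]; rewrite !inE.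
move=> /orP [/eqP ->|he] /orP [/eqP ->|he'] // E.
- by move: xs; rewrite E (map_f (fun e => e.1.1) he').
- by move: xs; rewrite -E (map_f (fun e => e.1.1) he).
by apply: IH.
Qed.

Local Notation vertex := 'I_(size ws).

Definition link_edges : {set {set vertex}} :=
  [set e | [exists v : vertex, exists w : vertex, (e == [set v; w]) &&
    (nat_of_ord w \in [seq x.1.1 | x <- (node v).2])]]%SET.

(** An edge is stored at its endpoint of larger index. [set2_eq] recovers this orientation from the
    unordered pair and [node_uniq] the entry, so the choice is forced on edges. *)
Definition edge_data (e : {set vertex}) : R * bool :=
  xget (1, false) [set x | exists v w : vertex,
    e = [set v; w]%SET /\ (nat_of_ord w, x.1, x.2) \in (node v).2].

Lemma set2_eq (v w v' w' : vertex) : [set v; w]%SET = [set v'; w']%SET ->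
  (w < v)%N -> (w' < v')%N -> v = v' /\ w = w'.
Proof.
move=> /setP E h h'.
have := E v; rewrite !inE eqxx /= => /esym /orP [/eqP v1|/eqP v1];
have := E w; rewrite !inE eqxx orbT /= => /esym /orP [/eqP w1|/eqP w1]; try (by split);
by move: h h'; rewrite v1 w1; lia.
Qed.

Lemma edge_dataP (v w : vertex) l b : (nat_of_ord w, l, b) \in (node v).2 ->
  edge_data [set v; w]%SET = (l, b).
Proof.
move=> h; apply: xget_subset1; first by exists v, w.
move=> [l1 b1] [l2 b2] [v1 [w1 [e1 h1]]] [v2 [w2 [e2 h2]]] /=.
have n1 := (node_edge (ltn_ord v1) h1).1; have n2 := (node_edge (ltn_ord v2) h2).1.
have [vv ww] : v1 = v2 /\ w1 = w2 by apply: set2_eq => //; rewrite -e1 -e2.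
by move: h1; rewrite vv ww => h1; have := node_uniq (ltn_ord v2) h1 h2 erefl; case=> -> ->.
Qed.

Lemma link_edgesP e : e \in link_edges -> exists (v w : vertex) l b,
  e = [set v; w]%SET /\ (nat_of_ord w, l, b) \in (node v).2.
Proof.
rewrite inE => /existsP [v /existsP [w /andP [/eqP -> /mapP [[[x l] b] h /= xw]]]].
by exists v, w, l, b; rewrite xw.
Qed.

Lemma link_edges_mem (v w : vertex) l b : (nat_of_ord w, l, b) \in (node v).2 ->
  [set v; w]%SET \in link_edges.
Proof.
move=> h; rewrite inE; apply/existsP; exists v; apply/existsP; exists w; rewrite eqxx /=.
by apply/mapP; exists (nat_of_ord w, l, b).
Qed.

Lemma link_edges_card e : e \in link_edges -> #|e| = 2.
Proof.
move=> /link_edgesP [v [w [l [b [-> h]]]]]; have [lt _] := node_edge (ltn_ord v) h.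
by rewrite cards2; case: eqP => // vw; move: lt; rewrite vw ltnn.
Qed.

Lemma link_edges_len e : e \in link_edges -> 0 < (edge_data e).1.
Proof.
move=> /link_edgesP [v [w [l [b [-> h]]]]]; rewrite (edge_dataP h).
by have [] := node_edge (ltn_ord v) h.
Qed.

Lemma link_flex_sub : [set e in link_edges | (edge_data e).2]%SET \subset link_edges.
Proof. by apply/fintype.subsetP => e; rewrite inE => /andP []. Qed.

Definition linkage_of : cabled_linkage R n := {|
  nv := size ws;
  edges := link_edges;
  edges_card2 := link_edges_card;
  len := fun e => (edge_data e).1;
  len_pos := link_edges_len;
  fixed := [set v : vertex | (node v).1 != None]%SET;
  mu := fun v : vertex => odflt 0 (node v).1;
  flex := [set e in link_edges | (edge_data e).2]%SET;
  flex_sub := link_flex_sub |}.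

(* Junk value 0 off the vertex set. *)
Definition position (phi : 'M[R]_(size ws, n)) (i : nat) : V :=
  if insub i is Some v then row v phi else 0.

Lemma positionE phi (v : vertex) : position phi v = row v phi.
Proof. by rewrite /position valK. Qed.

Lemma edist_le (u v : V) l : 0 <= l -> (Defs.edist u v <= l) = (nq (u - v) <= l ^+ 2).
Proof.
move=> l0; rewrite edist_nq -(@ler_sqr _ (Num.sqrt _)) ?nnegrE ?sqrtr_ge0 //.
by rewrite sqr_sqrtr // nq_ge0.
Qed.

Lemma edist_eq (u v : V) l : 0 <= l -> (Defs.edist u v = l <-> nq (u - v) = l ^+ 2).
Proof.
move=> l0; rewrite edist_nq; split=> [<-|->]; first by rewrite sqr_sqrtr // nq_ge0.
by rewrite sqrtr_sqr ger0_norm.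
Qed.

Lemma linkage_ofP phi : config_space linkage_of phi <-> satf 0 ws (position phi).
Proof.
rewrite satf_nth; split.
  move=> [h1 [h2 h3]] i hi; rewrite add0n -/(node i).
  pose v := Ordinal hi; have -> : i = v by [].
  split=> [z hz|].
    by have := h1 v; rewrite positionE /= inE hz => /(_ isT) ->.
  apply/alls_mem => -[[j l] b] h /=.
  have [jv l0] := node_edge hi h; rewrite /= in jv l0.
  pose w := Ordinal (ltn_trans jv hi); have jw : j = w by [].
  rewrite jw in h *; rewrite -[position phi i]/(position phi v) !positionE.
  have eE := link_edges_mem (v := v) h; have dE := edge_dataP (v := v) h.
  case: b h eE dE => h eE dE /=.
    rewrite -(edist_le _ _ (ltW l0)); have := h2 v w.
    by rewrite /= inE eE dE /=; apply.
  have nf : [set v; w]%SET \notin flex linkage_of by rewrite /= inE eE dE.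
  by apply/(edist_eq _ _ (ltW l0)); rewrite (h3 v w eE nf) /= dE.
move=> h.
have key (v w : vertex) : [set v; w]%SET \in link_edges ->
    cmp (edge_data [set v; w]%SET).2 (nq (row v phi - row w phi)) ((edge_data [set v; w]%SET).1 ^+ 2)
    /\ 0 <= (edge_data [set v; w]%SET).1.
  move=> he; split; last by apply/ltW/link_edges_len.
  have [v' [w' [l [b [E hb]]]]] := link_edgesP he.
  have [_ hs] := h v' (ltn_ord v').
  have := proj1 (alls_mem _ _) hs _ hb; rewrite add0n !positionE E (edge_dataP hb) /=.
  have nqC (x y : V) : nq (x - y) = nq (y - x) by rewrite -opprB /nq dotNl dotNr opprK.
  have [lt _] := node_edge (ltn_ord v') hb.
  (* Configurations are defined over ordered pairs, while an edge is listed only at its larger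
     endpoint; symmetry of the distance covers the other order. *)
  have [wv|vw] := ltnP w v; first by have [-> ->] := set2_eq E wv lt.
  have vw' : v != w by have := link_edges_card he; rewrite cards2; case: eqP.
  have vw2 : (v < w)%N by rewrite ltn_neqAle vw andbT; move: vw'; rewrite -val_eqE.
  have E' : [set w; v]%SET = [set v'; w']%SET by rewrite -E finset.setUC.
  by have [-> ->] := set2_eq E' vw2 lt; rewrite nqC.
split.
  move=> v; rewrite /= inE; have [h1 _] := h v (ltn_ord v).
  rewrite add0n positionE -/(node v) in h1.
  by case: (node v).1 h1 => [z h1 _|//] /=; apply: h1.
split=> v w.
  rewrite /= finset.in_set => /andP [he hb]; have [+ l0] := key v w he.
  by rewrite hb /= edist_le.
move=> he; rewrite /= finset.in_set he /= => /negbTE hb; have [+ l0] := key v w he.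
by rewrite hb /= => /(edist_eq _ _ l0).
Qed.

End LinkageOf.

(** * From linkages to polynomials *)

Section PolynomialFunctions.
Variables (R : realType) (a b : nat).
Notation I := ('I_a * 'I_b)%type.
Implicit Types (f g : 'M[R]_(a, b) -> R) (x : 'M[R]_(a, b)).

Definition entries (x : 'M[R]_(a, b)) : I -> R := fun ij => x ij.1 ij.2.

(** Coefficients on all multi-indices that vanish off a box can be moved to a larger box and
    multiplied by [conv], so the results on box sums apply. *)
Lemma poly_funP f : poly_fun f <-> exists d (c : (I -> nat) -> R),
  (forall al, ~~ mle al d -> c al = 0) /\
  forall x, f x = bsum d (fun al => c al * mon (entries x) al).
Proof.
have monE x (al : I -> nat) : \prod_(i < a) \prod_(j < b) x i j ^+ al (i, j) = mon (entries x) al.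
  by rewrite pair_bigA /=; apply: eq_bigr => -[].
split=> [[d [c h]]|[d [c [_ h]]]].
  exists d, (fun al => if mle al d then c [ffun ij => inord (al ij)] else 0).
  split=> [al /negbTE -> //|x]; rewrite h; apply: eq_bigr => al _.
  rewrite (monE x (fun ij => al ij)) mle_ord; congr (c _ * _).
  by apply/ffunP => ij; rewrite ffunE inord_val.
exists d, (fun al : {ffun I -> 'I_d.+1} => c (fun ij => nat_of_ord (al ij))) => x; rewrite h; apply: eq_bigr => al _.
by rewrite (monE x (fun ij => al ij)).
Qed.

Lemma poly_fun_at f (c : (I -> nat) -> R) d D : (d <= D)%N ->
  (forall al, ~~ mle al d -> c al = 0) ->
  (forall x, f x = bsum d (fun al => c al * mon (entries x) al)) ->
  forall x, f x = bsum D (fun al => c al * mon (entries x) al).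
Proof.
by move=> dD c0 h x; rewrite h -(bsum_widen dD) // => al /c0 ->; rewrite mul0r.
Qed.

Lemma poly_fun_const (k : R) : poly_fun (fun _ : 'M[R]_(a, b) => k).
Proof.
apply/poly_funP; exists 0%N, (fun al => if deg al == 0%N then k else 0); split=> [al|x].
  move=> /forallPn [i]; rewrite -ltnNge => hi; case: eqP => // /deg0P h.
  by rewrite h in hi.
by rewrite bsum0 /deg /mon !big1 ?mulr1 ?eqxx // => i _; rewrite expr0.
Qed.

Lemma poly_fun_coord i j : poly_fun (fun x : 'M[R]_(a, b) => x i j).
Proof.
pose e : I -> nat := fun ij => (ij == (i, j) : nat).
have e1 ij : (e ij <= 1)%N by rewrite /e; case: eqP.
apply/poly_funP; exists 1%N, (fun al => if `[< al = e >] then 1 else 0); split=> [al|x].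
  move=> /forallPn [ij hij]; case: asboolP => // h; by rewrite h e1 in hij.
rewrite /bsum (bigD1 [ffun ij => inord (e ij)]) //=.
have Ee : (fun i0 => nat_of_ord ([ffun ij => inord (e ij) : 'I_2] i0)) = e.
  by apply/funext => ij; rewrite ffunE inordK // ltnS e1.
rewrite Ee; case: asboolP => // _; rewrite big1 ?addr0 ?mul1r => [|al /eqP hal].
  rewrite /mon (bigD1 (i, j)) //= big1 ?mulr1 /e ?eqxx ?expr1 //.
  by move=> ij /negbTE ->; rewrite expr0.
case: asboolP => [h|_]; last by rewrite mul0r.
by case: hal; apply/ffunP => ij; apply/val_inj; rewrite ffunE /= -h inord_val.
Qed.

Lemma poly_funD f g : poly_fun f -> poly_fun g -> poly_fun (fun x => f x + g x).
Proof.
move=> /poly_funP [d [c [c0 hf]]] /poly_funP [d' [c' [c0' hg]]].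
apply/poly_funP; exists (maxn d d'), (fun al => c al + c' al); split=> [al h|x].
  have h1 : ~~ mle al d by apply: contra h => /(mleW (leq_maxl _ _)).
  have h2 : ~~ mle al d' by apply: contra h => /(mleW (leq_maxr _ _)).
  by rewrite c0 // c0' // addr0.
rewrite (poly_fun_at (leq_maxl d d') c0 hf) (poly_fun_at (leq_maxr d d') c0' hg) -bsumD.
by apply: eq_bsum => al _; rewrite mulrDl.
Qed.

Lemma poly_funM f g : poly_fun f -> poly_fun g -> poly_fun (fun x => f x * g x).
Proof.
move=> /poly_funP [d [c [c0 hf]]] /poly_funP [d' [c' [c0' hg]]].
apply/poly_funP; exists (d + d')%N, (conv c c'); split=> [al h|x].
  rewrite /conv /bsum big1 // => be _; case: ifP => // /forallP hle.
  have [h1|/c0 ->] := boolP (mle (fun i => be i) d); last by rewrite mul0r.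
  have [h2|/c0' ->] := boolP (mle (subm al (fun i => be i)) d'); last by rewrite mulr0.
  case/negP: h; apply/forallP => i; rewrite -(subnKC (hle i)).
  by apply: leq_add; [exact: (forallP h1)|exact: (forallP h2)].
have E : bsum (d + d') (fun al => conv c c' al * mon (entries x) al) =
    bsum (d + d') (conv (fun al => c al * mon (entries x) al) (fun al => c' al * mon (entries x) al)).
  by apply: eq_bsum => al _; rewrite conv_mon.
rewrite E bsum_conv (poly_fun_at (leq_addr d' d) c0 hf) (poly_fun_at (leq_addl d d') c0' hg) bsumM.
apply: eq_bsum => be _; apply: eq_bsum => ga _; case: ifP => // h.
have [h1|/c0 ->] := boolP (mle be d); last by rewrite !mul0r.
have [h2|/c0' ->] := boolP (mle ga d'); last by rewrite mul0r mulr0.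
case/negP: h; apply/forallP => i.
by apply: leq_add; [exact: (forallP h1)|exact: (forallP h2)].
Qed.

Lemma poly_fun_eq f g : (forall x, f x = g x) -> poly_fun f -> poly_fun g.
Proof. by move=> h [d [c hc]]; exists d, c => x; rewrite -h. Qed.

Lemma poly_funB f g : poly_fun f -> poly_fun g -> poly_fun (fun x => f x - g x).
Proof.
move=> pf pg.
by apply: poly_fun_eq (poly_funD pf (poly_funM (poly_fun_const (-1)) pg)) => x; rewrite mulN1r.
Qed.

Lemma poly_fun_sum (J : Type) (r : seq J) (F : J -> 'M[R]_(a, b) -> R) :
  (forall k, poly_fun (F k)) -> poly_fun (fun x => \sum_(k <- r) F k x).
Proof.
move=> h; elim: r => [|k r IH].
  by apply: poly_fun_eq (poly_fun_const 0) => x; rewrite big_nil.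
by apply: poly_fun_eq (poly_funD (h k) IH) => x; rewrite big_cons.
Qed.

End PolynomialFunctions.

Section AnalyticMaps.
Variables (R : realType).

Lemma continuous_mx (a b c d : nat) (h : 'M[R]_(a, b) -> 'M[R]_(c, d)) x :
  (forall i j, {for x, continuous (fun y => h y i j)}) -> {for x, continuous h}.
Proof.
move=> hc; apply/(@cvgrPdist_lt _ _ _ (nbhs x) _) => e e0.
have H : \forall y \near nbhs x, forall i j, `|h x i j - h y i j| < e.
  apply: filter_forall => i; apply: filter_forall => j.
  by have /(@cvgrPdist_lt _ _ _ (nbhs x) _) /(_ e e0) := hc i j.
apply: filterS H => y hy; have : ball (h x) e (h y) by split=> // i j; apply: hy.
by rewrite mx_norm_ball.
Qed.

Lemma analytic_map_cont (a b c d : nat) (U : set 'M[R]_(a, b)) (H : 'M[R]_(a, b) -> 'M[R]_(c, d)) x :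
  analytic_map_on U H -> U x -> {for x, continuous H}.
Proof.
move=> [_ h] Ux; apply: continuous_mx => i j; apply: analytic_at_cont.
by have /analytic_fun_onP [_] := h i j; apply.
Qed.

Lemma analytic_restriction_within (a b c d : nat) (A : set 'M[R]_(a, b))
    (h : 'M[R]_(a, b) -> 'M[R]_(c, d)) :
  analytic_restriction A h -> {within A, continuous h}.
Proof.
move=> [U [AU [H [aH E]]]].
have cH : {within A, continuous H}.
  by apply: continuous_in_subspaceT => x /set_mem /AU; apply: analytic_map_cont.
by apply: subspace_eq_continuous cH => x /set_mem Ax; apply: E.
Qed.

Lemma analytic_coord_map (a b c d : nat) (A : set 'M[R]_(a, b)) (h : 'M[R]_(a, b) -> 'M[R]_(c, d)) :
  (forall i j, exists i' j', forall x, h x i j = x i' j') -> analytic_restriction A h.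
Proof.
move=> hc; exists setT; split=> //; exists h; split=> //; split; first exact: openT.
move=> i j; apply/analytic_fun_onP; split; first exact: openT.
have [i' [j' E]] := hc i j; have -> : (fun x => h x i j) = (fun x => x i' j') by apply/funext.
by move=> x _; apply: analytic_at_coord.
Qed.

End AnalyticMaps.

Section FromLinkage.
Variables (R : realType) (n k m : nat) (X : set 'M[R]_(k, n)) (f : 'M[R]_(k, n) -> 'M[R]_(m, n)).

Lemma config_space_quasialgebraic (L : cabled_linkage R n) :
  quasialgebraic [set x : 'rV[R]_(nv L * n) | config_space L (vec_mx x)].
Proof.
pose c (v : 'I_(nv L)) (j : 'I_n) (x : 'rV[R]_(nv L * n)) : R := x ord0 (mxvec_index v j).
have pc v j : poly_fun (c v j) by apply: poly_fun_coord.
pose d v w x := \sum_(j <- index_enum 'I_n) (c v j x - c w j x) * (c v j x - c w j x).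
have pd v w : poly_fun (d v w).
  by apply: poly_fun_sum => j; apply: poly_funM; apply: poly_funB.
have dE v w x : nq (row v (vec_mx x) - row w (vec_mx x)) = d v w x.
  by apply: eq_bigr => j _; rewrite !mxE.
pose J1 := ('I_(nv L) * 'I_n + 'I_(nv L) * 'I_(nv L))%type.
pose J2 := ('I_(nv L) * 'I_(nv L))%type.
(* All coordinates and all pairs of vertices serve as indices; where the linkage imposes nothing,
   the polynomial is 0. *)
pose P (z : J1) (x : 'rV[R]_(nv L * n)) : R := match z with
  | inl vj => if vj.1 \in fixed L then c vj.1 vj.2 x - @mu _ _ L vj.1 ord0 vj.2 else 0
  | inr vw => if ([set vw.1; vw.2]%SET \in edges L) && ([set vw.1; vw.2]%SET \notin flex L)
     then d vw.1 vw.2 x - @len _ _ L [set vw.1; vw.2]%SET ^+ 2 else 0 end.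
pose Q (vw : J2) (x : 'rV[R]_(nv L * n)) : R := if [set vw.1; vw.2]%SET \in flex L
     then @len _ _ L [set vw.1; vw.2]%SET ^+ 2 - d vw.1 vw.2 x else 0.
have pP z : poly_fun (P z).
  case: z => [[v j]|[v w]]; rewrite /P /=.
    case: (v \in fixed L); last exact: poly_fun_const.
    by apply: poly_funB; [exact: pc|exact: poly_fun_const].
  case: (_ && _); last exact: poly_fun_const.
  by apply: poly_funB; [exact: pd|exact: poly_fun_const].
have pQ z : poly_fun (Q z).
  case: z => v w; rewrite /Q /=; case: (_ \in flex L); last exact: poly_fun_const.
  by apply: poly_funB; [exact: poly_fun_const|exact: pd].
exists #|{: J1}|, #|{: J2}|, (fun i : 'I_#|{: J1}| => P (enum_val i)), (fun i : 'I_#|{: J2}| => Q (enum_val i)).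
split; first by move=> i; apply: pP.
split; first by move=> i; apply: pQ.
have lpos e : e \in edges L -> 0 <= @len _ _ L e by move=> /len_pos /ltW.
apply/seteqP; split=> x /=.
  move=> [h1 [h2 h3]]; split.
    move=> i; rewrite /P; case: (enum_val i) => [[v j]|[v w]] /=; case: ifP => // h.
      by rewrite -(h1 v h) !mxE /c subrr.
    move: h => /andP [he hf]; have := h3 v w he hf.
    by move/(edist_eq _ _ (lpos _ he)); rewrite dE => ->; rewrite subrr.
  move=> i; rewrite /Q; case: (enum_val i) => v w /=; case: ifP => // h.
  have he := fintype.subsetP (flex_sub L) _ h.
  by have := h2 v w h; rewrite edist_le ?lpos // dE subr_ge0.
move=> [hP0 hQ0].
have hP z : P z x = 0 by have := hP0 (enum_rank z); rewrite enum_rankK.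
have hQ z : 0 <= Q z x by have := hQ0 (enum_rank z); rewrite enum_rankK.
split; [|split].
- move=> v hv; apply/rowP => j; have := hP (inl (v, j)); rewrite /P /= hv => /eqP.
  by rewrite subr_eq0 => /eqP <-; rewrite !mxE.
- move=> v w h; have he := fintype.subsetP (flex_sub L) _ h.
  by have := hQ (v, w); rewrite /Q /= h edist_le ?lpos // dE subr_ge0.
- move=> v w he hf; have := hP (inr (v, w)); rewrite /P /= he hf /= => /eqP.
  by rewrite subr_eq0 => /eqP h; apply/edist_eq; [exact: lpos|rewrite dE].
Qed.

Lemma linkage_quasialgebraic (L : cabled_linkage R n) : strongly_functional L f X ->
  exists (N : nat) (Y : set 'rV[R]_N) (q : 'rV[R]_N -> 'M[R]_(k, n)) (p : 'rV[R]_N -> 'M[R]_(m, n)),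
    quasialgebraic Y /\ poly_map q /\ poly_map p /\ q @` Y `<=` X /\
    (forall y, Y y -> p y = f (q y)) /\ analytic_iso Y X q.
Proof.
move=> [w [v]]; set qL := fun phi : 'M[R]_(nv L, n) => _; set pL := fun phi : 'M[R]_(nv L, n) => _.
move=> [hp [hX [_ [g [gq [qg [_ [_ [aq ag]]]]]]]]].
pose Y : set 'rV[R]_(nv L * n) := [set x | config_space L (vec_mx x)].
pose q (x : 'rV[R]_(nv L * n)) := qL (vec_mx x).
pose p (x : 'rV[R]_(nv L * n)) := pL (vec_mx x).
have qE x i j : q x i j = x ord0 (mxvec_index (w i) j) by rewrite !mxE.
have pE x i j : p x i j = x ord0 (mxvec_index (v i) j) by rewrite !mxE.
have qY : q @` Y = X.
  rewrite -hX; apply/seteqP; split=> _ [x hx <-]; first by exists (vec_mx x).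
  by exists (mxvec x); rewrite /Y /q /= mxvecK.
exists (nv L * n)%N, Y, q, p; split; first exact: config_space_quasialgebraic.
split; first by move=> i j; apply: poly_fun_eq (poly_fun_coord _ ord0 _) => x; rewrite qE.
split; first by move=> i j; apply: poly_fun_eq (poly_fun_coord _ ord0 _) => x; rewrite pE.
split; first by rewrite qY.
split; first by move=> y Yy; apply: hp.
have aqY : analytic_restriction Y q.
  by apply: analytic_coord_map => i j; exists ord0, (mxvec_index (w i) j) => x; rewrite qE.
have agX : analytic_restriction X (fun x => mxvec (g x)).
  have [U [XU [H [[oU aH] E]]]] := ag; exists U; split=> //; exists (fun x => mxvec (H x)).
  split; last by move=> x Xx; rewrite E.
  split=> // i j; case/mxvec_indexP: j => i' j'.
  rewrite (_ : (fun x => _) = (fun x => H x i' j')); first exact: aH.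
  by apply/funext => x; rewrite (ord1 i) mxvecE.
split=> //; exists (fun x => mxvec (g x)); split.
  by move=> x Yx; rewrite /q gq // vec_mxK.
split; first by move=> x Xx; rewrite /q mxvecK qg.
by do !split=> //; apply: analytic_restriction_within.
Qed.

End FromLinkage.

(** * From polynomials to linkages *)

Section NiceAlongMap.
Variables (R : realType) (k n N : nat) (X : set 'M[R]_(k, n)) (G : 'M[R]_(k, n) -> 'rV[R]_N).
Variable D : 'rV[R]_N -> Prop.
Hypothesis GD : forall x, X x -> D (G x).

(** What must be analytic in the end is each vertex as a function of the input, that is [h] composed
    with [G]. The neighbourhood [U] depends on [h], since every inverse or square root shrinks it to
    where its argument stays nonzero or positive. *)
Definition analytic_along (h : 'rV[R]_N -> R) := exists U : set 'M[R]_(k, n),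
  [/\ open U, X `<=` U & forall x, U x -> analytic_at (fun x => h (G x)) x].

Lemma open_analytic_preimage (U : set 'M[R]_(k, n)) (h : 'M[R]_(k, n) -> R) (A : set R) :
  open U -> (forall x, U x -> analytic_at h x) -> open A -> open (U `&` [set x | A (h x)]).
Proof.
move=> oU hU oA; rewrite openE => x [Ux Ax]; apply: filterI.
  by move: oU; rewrite openE; apply.
have /(_ A) := analytic_at_cont (hU x Ux); apply.
by move: oA; rewrite openE; apply.
Qed.

Lemma analytic_along_class : nice_class D analytic_along.
Proof.
split=> [c|f g [U [oU XU hU]] [U' [oU' XU' hU']]|f g [U [oU XU hU]] [U' [oU' XU' hU']]
  |f [U [oU XU hU]] f0|f [U [oU XU hU]] f0].
- by exists setT; split=> // [|x _]; [exact: openT|exact: has_germ_const].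
- exists (U `&` U'); split; [exact: openI|by move=> x Xx; split; [apply: XU|apply: XU']|].
  by move=> x [Ux U'x]; apply: has_germD; [apply: hU|apply: hU'].
- exists (U `&` U'); split; [exact: openI|by move=> x Xx; split; [apply: XU|apply: XU']|].
  by move=> x [Ux U'x]; apply: has_germM; [apply: hU|apply: hU'].
- exists (U `&` [set x | [set y | y != 0] (f (G x))]); split.
  + by apply: (@open_analytic_preimage U (fun x => f (G x)) _ oU hU); apply: open_neq.
  + by move=> x Xx; split; [apply: XU|apply: f0; apply: GD].
  + by move=> x [Ux fx]; apply: has_germV; [apply: hU|rewrite shift_mx0].
- exists (U `&` [set x | [set y | y > 0] (f (G x))]); split.
  + by apply: (@open_analytic_preimage U (fun x => f (G x)) _ oU hU); apply: open_gt.
  + by move=> x Xx; split; [apply: XU|apply: f0; apply: GD].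
  + by move=> x [Ux fx]; apply: has_germ_sqrt; [apply: hU|rewrite shift_mx0].
Qed.

End NiceAlongMap.

Section ToLinkage.
Variables (R : realType) (n k m : nat) (X : set 'M[R]_(k, n)) (f : 'M[R]_(k, n) -> 'M[R]_(m, n)).
Variables (i0 i1 : 'I_n).
Hypothesis i01 : i0 != i1.

Lemma alls_enum (J : finType) (A : J -> Prop) : alls A (index_enum J) <-> forall j, A j.
Proof.
by split=> [/alls_mem h j|h]; [apply: h; rewrite mem_index_enum|apply/alls_mem => j _].
Qed.

Lemma compact_coord_bounded N (A : set 'rV[R]_N) : compact A ->
  exists2 B : R, 0 < B & forall y, A y -> forall l, `|y ord0 l| <= B.
Proof.
move=> /compact_bounded [M [_ hM]]; exists (`|M| + 1); first by rewrite ltr_wpDl.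
move=> y Ay l; have /(_ y Ay) hy := hM (`|M| + 1) (ltr_pwDr ltr01 (ler_norm M)).
apply: le_trans hy; rewrite [leRHS]mx_normrE.
exact: (le_bigmax _ (fun ij => `|y ij.1 ij.2|) (ord0, l)).
Qed.

Lemma quasialgebraic_linkage N (Y : set 'rV[R]_N) (q : 'rV[R]_N -> 'M[R]_(k, n))
    (p : 'rV[R]_N -> 'M[R]_(m, n)) : compact X ->
  quasialgebraic Y -> poly_map q -> poly_map p -> (forall y, Y y -> p y = f (q y)) ->
  analytic_iso Y X q -> exists L : cabled_linkage R n, strongly_functional L f X.
Proof.
move=> cX [s [t [P [Q [pP [pQ YE]]]]]] pq pp hp [qY [g [gq [qg [_ [cg [_ ag]]]]]]].
have gY x : X x -> Y (g x) by rewrite -qY => -[y Yy <-]; rewrite gq.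
(* Compactness passes from [X] to [Y] through the continuous inverse [g]; it provides the box of the
   free variables. *)
have cY : compact Y.
  have -> : Y = g @` X.
    apply/seteqP; split=> [y Yy|_ [x Xx <-]]; last exact: gY.
    by exists (q y); [rewrite -qY; exists y|rewrite gq].
  exact: continuous_compact cg cX.
have [B B0 hB] := compact_coord_bounded cY.
have [U0 [XU0 [G [[oU0 aG] Gg]]]] := ag.
pose D := box (R := R) (N := N) B N.
have YD y : Y y -> D y by move=> Yy l _; apply: hB.
have D0 : D 0 by move=> l _; rewrite mxE normr0 ltW.
have GD x : X x -> D (G x) by move=> Xx; rewrite Gg //; apply/YD/gY.
pose nice := analytic_along X G.
have niceP : nice_class D nice := analytic_along_class GD.
have nice_coord (l : 'I_N) : nice (fun y => y ord0 l).
  by exists U0; split=> // x Ux; have /analytic_fun_onP [_] := aG ord0 l; apply.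
(* In the frame [(i1, i0)], [con_line_variable] delivers the variables along [e_i0], the axis on
   which the scalar operations take place. *)
have i10 : i1 != i0 by rewrite eq_sym.
have nice_circle (l : 'I_N) : vnice nice (fun y => circle_pt i1 i0 (tvar B l y)).
  have nt : nice (tvar (N := N) B l) by apply: (nice_mul niceP) => //; apply: nice_cst niceP _.
  have t0 (y : 'rV[R]_N) : 1 + tvar B l y ^+ 2 != 0 by rewrite gt_eqF // ltr_wpDr // sqr_ge0.
  have ni : nice (fun y => (1 + tvar B l y ^+ 2)^-1).
    apply: (nice_inv niceP) => //.
    by apply: (nice_add niceP); [apply: nice_cst niceP _|exact: (nice_sqr niceP nt)].
  rewrite (_ : (fun y => _) = (fun y => pl i1 i0 ((1 + tvar B l y ^+ 2)^-1 - 2^-1)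
     (tvar B l y / (1 + tvar B l y ^+ 2)))); last by apply/funext => y; rewrite circle_ptE.
  apply: (vnice_pl niceP); last exact: (nice_mul niceP).
  by apply: (nice_sub niceP) => //; apply: nice_cst niceP _.
have [S0 [gS0 _ hS0]] := variables_state (nice_cst niceP) i10 B0 nice_circle (leqnn N).
have scal_var (l : 'I_N) : scal D nice S0 i0 (fun y => y ord0 l).
  have cQ : con D nice S0 (fun y => circle_pt i1 i0 (tvar B l y)).
    apply: con_rigid => [|S gS e].
      by exists 2^-1 => [|u _]; [rewrite invr_gt0|rewrite circle_pt_nq].
    exists S; split=> //; first exact: ext_refl.
    have [x [hx ex]] := hS0 l (ltn_ord l); apply: (vtxat_ext gS0 e).
    by exists x; split=> // u _.
  have ki : con D nice S0 (fun=> ek R i1) by apply: con_const.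
  have ht u : D u -> `|tvar B l u| <= 1 / 4.
    move=> Du; have B40 : 0 < 4 * B by rewrite mulr_gt0.
    rewrite /tvar normrM normrV ?unitfE ?gt_eqF // (gtr0_norm B40) ler_pdivrMr //.
    by have := Du l (ltn_ord l); lra.
  have ct : con D nice S0 (fun u => tvar B l u *: ek R i0).
    apply: (con_line_variable niceP D0 i10 _ ht).
    apply: con_eq (con_add cQ (con_scale niceP 2^-1 ki)) => u _.
    by rewrite /circle_pt subrK.
  have st : scal D nice S0 i0 (tvar B l) by split=> //; exists (1 / 4).
  apply: scal_eq (scal_scale niceP (4 * B) st) => u _.
  by rewrite /tvar mulrC divfK // mulf_neq0 // gt_eqF.
have scal_poly h : poly_fun h -> scal D nice S0 i0 h.
  move=> [d [c hc]].
  apply: scal_eq (_ : scal D nice S0 i0 (fun x => \sum_(al : {ffun 'I_1 * 'I_N -> 'I_d.+1})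
    c al * \prod_(i < 1) \prod_(j < N) x i j ^+ al (i, j))) => [u _|]; first by rewrite hc.
  apply: (scal_sum niceP) => al; apply: (scal_scale niceP).
  apply: (scal_prod niceP D0 i01) => i; apply: (scal_prod niceP D0 i01) => j.
  by apply: (scal_exp niceP D0 i01); rewrite (ord1 i).
pose J := ('I_k + 'I_m + ('I_s + 'I_t))%type.
pose F (z : J) (y : 'rV[R]_N) : 'rV[R]_n := match z with
  | inl (inl i) => row i (q y) | inl (inr i) => row i (p y)
  | inr (inl i) => P i y *: ek R i0 | inr (inr j) => Q j y *: ek R i0 end.
have conF z : con D nice S0 (F z).
  case: z => [[i|i]|[i|i]] /=.
  - apply: (con_vector niceP D0 (i := i0)) => l; apply: scal_poly.
    by apply: poly_fun_eq (pq i l) => x; rewrite mxE.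
  - apply: (con_vector niceP D0 (i := i0)) => l; apply: scal_poly.
    by apply: poly_fun_eq (pp i l) => x; rewrite mxE.
  - exact: (scal_poly _ (pP i)).1.
  - exact: (scal_poly _ (pQ i)).1.
have [S1 [e1 g1 h1]] := con_vertices (enum {: J}) niceP D0 conF gS0 (ext_refl S0).
have /choice [x hx] : forall z : J, exists i, vat D S1 i (F z).
  by move=> z; apply: h1; rewrite mem_enum.
have /choice [K hK] : forall j : 'I_t, exists K : R, 0 < K /\ forall y, D y -> `|Q j y| <= K.
  move=> j; have [_ [M hM]] := scal_poly _ (pQ j).
  exists (`|M| + 1); split; first by rewrite ltr_wpDl.
  by move=> y Dy; apply: le_trans (hM y Dy) _; apply: le_trans (ler_norm M) _; rewrite lerDl.
(* P = 0 is |P e - e| <= 1 together with |P e + e| <= 1; and, when |Q| <= K, Q >= 0 is |Q e - K e| <= K. *)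
pose cs : seq (nat * 'rV[R]_n * R * bool) :=
  [seq (x (inr (inl i)), ek R i0, 1, true) | i <- index_enum 'I_s] ++
  [seq (x (inr (inl i)), - ek R i0, 1, true) | i <- index_enum 'I_s] ++
  [seq (x (inr (inr j)), K j *: ek R i0, K j, true) | j <- index_enum 'I_t].
have [|S [eS gS]] := add_cuts (nice_cst niceP) g1 (cs := cs).
  rewrite !alls_cat !alls_map !alls_enum; split; [|split] => z /=; split=> //;
    by [have [] := hx (inr (inl z))|have [] := hx (inr (inr z))|have [] := hK z].
have {}gS : good nice Y S.
  apply: good_iff gS => u.
  have nqe (a : R) : nq (a *: ek R i0) = a ^+ 2.
    by rewrite /nq !dotE -/(nq _) nq_ek mulr1 expr2.
  rewrite !alls_cat !alls_map !alls_enum; split.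
    move=> [Du [a1 [a2 a3]]]; rewrite YE; split=> [i|j].
      have := a1 i; rewrite /cut_ok /= (hx _).2 // /F -[X in _ - X]scale1r -scalerBl nqe => b1.
      have := a2 i; rewrite /cut_ok /= (hx _).2 // /F opprK -[X in _ + X]scale1r -scalerDl nqe => b2.
      by move: b1 b2; rewrite !expr2; nra.
    have := a3 j; rewrite /cut_ok /= (hx _).2 // /F -scalerBl nqe.
    by have [K0 _] := hK j; move: (K j) (Q j u) K0 => K' Q'; rewrite !expr2; nra.
  move=> Yu; have Du := YD u Yu; split=> //.
  have [hPu hQu] : (forall i, P i u = 0) /\ (forall j, 0 <= Q j u) by move: Yu; rewrite YE.
  split; [|split] => z; rewrite /cut_ok /= (hx _).2 // /F.
  - by rewrite hPu scale0r sub0r -scaleN1r nqe sqrrN.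
  - by rewrite hPu scale0r sub0r opprK -[X in nq X]scale1r nqe.
  - have [K0 /(_ u Du)] := hK z; have := hQu z; rewrite -scalerBl nqe => Q0.
    by rewrite ger0_norm // => QK; move: (K z) (Q z u) K0 Q0 QK => K' Q'; rewrite !expr2; nra.
have vS z : vat Y S (x z) (F z).
  have [hz ez] := hx z; split; first exact: leq_trans hz (ext_sz eS).
  by move=> u Yu; rewrite (ext_fn g1 eS hz) ez //; apply: YD.
have [szS wfS nS satS] := gS.
pose pos (y : 'rV[R]_N) : 'M[R]_(size (vs S), n) := \matrix_(v, l) fn S v y ord0 l.
have rowpos y (v : 'I_(size (vs S))) : row v (pos y) = fn S v y by apply/rowP => l; rewrite !mxE.
have configE phi : config_space (linkage_of wfS) phi <-> exists2 y, Y y & phi = pos y.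
  rewrite linkage_ofP satS; split=> [[y [Yy hy]]|[y Yy ->]].
    exists y => //; apply/row_matrixP => v; rewrite rowpos -hy; last exact: ltn_ord.
    by rewrite positionE.
  by exists y; split=> // v hv; rewrite -[v]/(nat_of_ord (Ordinal hv)) positionE rowpos.
exists (linkage_of wfS).
pose w (i : 'I_k) : 'I_(size (vs S)) := Ordinal (vS (inl (inl i))).1.
pose v (i : 'I_m) : 'I_(size (vs S)) := Ordinal (vS (inl (inr i))).1.
exists w, v; set qL := fun phi : 'M[R]_(_, n) => _; set pL := fun phi : 'M[R]_(_, n) => _.
have qpos y : Y y -> qL (pos y) = q y.
  by move=> Yy; apply/matrixP => i l; rewrite !mxE (vS (inl (inl i))).2 // mxE.
have ppos y : Y y -> pL (pos y) = p y.
  by move=> Yy; apply/matrixP => i l; rewrite !mxE (vS (inl (inr i))).2 // mxE.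
split; first by move=> phi /configE [y Yy ->]; rewrite ppos // qpos // hp.
have qLX : qL @` config_space (linkage_of wfS) = X.
  rewrite -qY; apply/seteqP; split=> [_ [phi /configE [y Yy ->] <-]|_ [y Yy <-]].
    by exists y; rewrite ?qpos.
  by exists (pos y); [apply/configE; exists y|rewrite qpos].
split=> //.
have aq : analytic_restriction (config_space (linkage_of wfS)) qL.
  by apply: analytic_coord_map => i l; exists (w i), l => phi; rewrite mxE.
have aG' : analytic_restriction X (fun z => pos (g z)).
  (* Each coordinate of each vertex is analytic on its own neighbourhood of [X]; being finitely
     many, these have an open intersection. *)
  have /choice [U hU] : forall vl : 'I_(size (vs S)) * 'I_n, exists U : set 'M[R]_(k, n),
      [/\ open U, X `<=` U & forall z, U z -> analytic_at (fun z => fn S vl.1 (G z) ord0 vl.2) z].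
    by move=> [v' l]; apply: nS; exact: ltn_ord.
  exists [set z | forall vl, U vl z]; split; first by move=> z Xz vl; have [_ XU _] := hU vl; apply: XU.
  exists (fun z => pos (G z)); split; last by move=> z Xz; rewrite Gg.
  have oU : open [set z | forall vl, U vl z].
    rewrite openE => z Uz; have H : \forall z' \near nbhs z, forall v' l, U (v', l) z'.
      apply: filter_forall => v'; apply: filter_forall => l.
      by have [oU _ _] := hU (v', l); apply: open_nbhs_nbhs.
    by apply: filterS H => z' h [v' l].
  split=> // v' l; apply/analytic_fun_onP; split=> // z Uz.
  have [_ _ /(_ z (Uz (v', l)))] := hU (v', l).
  by congr analytic_at; apply/funext => z'; rewrite mxE.
split=> //; exists (fun z => pos (g z)); split.
  by move=> phi /configE [y Yy ->]; rewrite qpos // gq.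
split; first by move=> z Xz; rewrite qpos ?qg //; apply: gY.
by do !split=> //; apply: analytic_restriction_within.
Qed.

End ToLinkage.

Theorem theorem6p3 (R : realType) (n k m : nat) (X : set 'M[R]_(k,n))
    (f : 'M[R]_(k,n) -> 'M[R]_(m,n)) :
  (2 <= n)%N -> compact X ->
  ((exists L : cabled_linkage R n, strongly_functional L f X) <->
   (exists (N : nat) (Y : set 'rV[R]_N) (q : 'rV[R]_N -> 'M[R]_(k,n))
           (p : 'rV[R]_N -> 'M[R]_(m,n)),
      quasialgebraic Y /\ poly_map q /\ poly_map p /\ q @` Y `<=` X /\
      (forall y, Y y -> p y = f (q y)) /\
      analytic_iso Y X q)).
Proof.
move=> n2 cX; split=> [[L]|[N [Y [q [p [qaY [pq [pp [_ [hp iso]]]]]]]]]].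
  exact: linkage_quasialgebraic.
pose i0 : 'I_n := Ordinal (ltnW n2); pose i1 : 'I_n := Ordinal n2.
have i01 : i0 != i1 by [].
exact: (quasialgebraic_linkage i01 cX qaY pq pp hp iso).
Qed.
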